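(* Let $k\ge 1$ be an integer, and consider the region obtained from the $(2k-1)$ by $2k$ undented Aztec rectangle by removing one unit square that shares an edge with the central square. If $k=2q$ with $q\ge1$, the number of domino tilings of this region is $$\frac{2^{(2q)^2+2q-1}}{V_{2q-2}V_{2q-1}}\;\prod_{d=1}^{q-1}(2d)^{4q-4d-1}\;\prod_{d=1}^{q-1}(2d+1)^{2d}\;\prod_{d=0}^{q-1}(2q+1+2d)^{2q-1-2d},$$ that is, $\frac{2^{(2q)^2+2q-1}}{V_{2q-2}V_{2q-1}}\,2^{4q-5}4^{4q-9}\cdots(2q-2)^3\cdot 3^2 5^4\cdots(2q-1)^{2q-2}(2q+1)^{2q-1}(2q+3)^{2q-3}\cdots(4q-3)^3(4q-1)$. If $k=2q+1$ with $q\ge 0$, the number of domino tilings is $$\frac{2^{(2q+1)^2+(2q+1)-1}}{V_{2q-1}V_{2q}}\;\prod_{d=1}^{q}(2d)^{4q-4d+1}\;\prod_{d=1}^{q-1}(2d+1)^{2d}\;(2q+1)^{2q}\;\prod_{d=1}^{q}(2q+1+2d)^{2q+1-2d},$$ that is, $\frac{2^{(2q+1)^2+(2q+1)-1}}{V_{2q-1}V_{2q}}\,2^{4q-3}4^{4q-7}\cdots(2q-2)^5(2q)\cdot 3^2 5^4\cdots(2q-1)^{2q-2}(2q+1)^{2q}(2q+3)^{2q-1}\cdots(4q-1)^3(4q+1)$.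
   Context: $V_n=1!\,2!\cdots n!=\prod_{m=1}^n m!$, with $V_0=V_{-1}=1$ (empty products). The $a$ by $b$ undented Aztec rectangle is the union of all unit squares with integer vertices contained in the region of the plane given by $x+y\le b+1$, $x+y\ge b-2a-1$, $y-x\le b+1$, $y-x\ge-(b+1)$. A domino is a $1$ by $2$ (or $2$ by $1$) rectangle made of two edge-adjacent unit squares; a domino tiling of a region is a partition of its unit squares into dominoes. For $a=2k-1$, $b=2k$ the center of the region is the point $(1/2,1/2)$ and the central square is $[0,1]\times[0,1]$. *)

(* Defs.v *)
From mathcomp Require Import all_boot all_order all_algebra.
From mathcomp Require Import finmap zify lra.

Set Implicit Arguments.
Unset Strict Implicit.
Unset Printing Implicit Defensive.

Import Order.TTheory GRing.Theory Num.Theory.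
Local Open Scope ring_scope.

(* The cell (i, j) is the unit square [i, i + 1] x [j, j + 1]. *)
Definition cell : Type := (int * int)%type.

Definition in_cell (R : realDomainType) (c : cell) (p : R * R) : bool :=
  (c.1%:~R <= p.1 <= c.1%:~R + 1) && (c.2%:~R <= p.2 <= c.2%:~R + 1).

Definition aztec_region (R : realDomainType) (a b : nat) (p : R * R) : bool :=
  [&& p.1 + p.2 <= b%:R + 1,
      p.1 + p.2 >= b%:R - 2 * a%:R - 1,
      p.2 - p.1 <= b%:R + 1
    & p.2 - p.1 >= - (b%:R + 1)].

(* The points of [aztec_region a b] have both coordinates between
   - (a + 1) and b + 1. *)
Definition aztec_range (a b : nat) : seq int :=
  [seq n%:Z - a.+1%:Z | n <- iota 0 (a + b + 3)].

(* Containment of a unit square, tested on its vertices, the region being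
   convex; [aztec_rectangleP] below is the characterization by all points. *)
Definition cell_in_aztec_region (a b : nat) (c : cell) : bool :=
  [&& aztec_region a b (c.1, c.2), aztec_region a b (c.1 + 1, c.2),
      aztec_region a b (c.1, c.2 + 1) & aztec_region a b (c.1 + 1, c.2 + 1)].

Definition aztec_rectangle (a b : nat) : {fset cell} :=
  [fset c in [seq (x, y) | x <- aztec_range a b, y <- aztec_range a b]
     | cell_in_aztec_region a b c]%fset.

Lemma mem_aztec_range (a b : nat) (x : int) :
  (x \in aztec_range a b) = (- a.+1%:Z <= x <= b%:Z + 1).
Proof.
apply/mapP/idP => [[n]|h]; first by rewrite mem_iota => ? ->; lia.
by exists (absz (x + a.+1%:Z)); rewrite ?mem_iota; lia.
Qed.

Lemma mem_aztec_rectangle (a b : nat) (c : cell) :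
  (c \in aztec_rectangle a b) =
  [&& c.1 + c.2 + 2 <= b%:Z + 1, b%:Z - 2 * a%:Z - 1 <= c.1 + c.2,
      c.2 - c.1 + 1 <= b%:Z + 1 & - (b%:Z + 1) <= c.2 - c.1 - 1].
Proof.
case: c => x y; rewrite !inE /= /cell_in_aztec_region /aztec_region /= !natz.
apply/andP/idP => [[_]|h]; first lia.
split; last lia.
apply/allpairsP; exists (x, y); rewrite /= !mem_aztec_range.
by split=> //; lia.
Qed.

Lemma aztec_rectangleP (R : realFieldType) (a b : nat) (c : cell) :
  c \in aztec_rectangle a b <->
  forall p : R * R, in_cell c p -> aztec_region a b p.
Proof.
rewrite mem_aztec_rectangle -!(ler_int R); case: c => x y /=.
rewrite !(rmorphD, rmorphB, rmorphN, rmorphM) /= -!pmulrn.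
rewrite /in_cell /aztec_region /=; move: (x%:~R : R) (y%:~R : R) => u v.
split=> [/and4P[? ? ? ?] [s t] /= /andP[/andP[? ?] /andP[? ?]]|h].
  by apply/and4P; split; lra.
have /and4P[/= ? _ _ _] := h (u + 1, v + 1) ltac:(rewrite /=; lra).
have /and4P[/= _ ? _ _] := h (u, v) ltac:(rewrite /=; lra).
have /and4P[/= _ _ ? _] := h (u, v + 1) ltac:(rewrite /=; lra).
have /and4P[/= _ _ _ ?] := h (u + 1, v) ltac:(rewrite /=; lra).
by apply/and4P; split; lra.
Qed.

Definition edge_adjacent (c c' : cell) : bool :=
  `|c.1 - c'.1| + `|c.2 - c'.2| == 1.

(* A region is a finite set of unit squares; the subsets of a region [A] are
   taken in the finite type [A] of its squares. *)
Definition is_domino (A : {fset cell}) (D : {set A}) : bool :=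
  [exists c : A, exists c' : A,
     edge_adjacent (val c) (val c') && (D == [set c; c'])].

Definition is_domino_tiling (A : {fset cell}) (T : {set {set A}}) : bool :=
  partition T [set: A] && [forall D in T, is_domino D].

Definition num_domino_tilings (A : {fset cell}) : nat :=
  #|[set T : {set {set A}} | is_domino_tiling T]|.

(* V_n = 1! 2! ... n!, indexed by int so that V_(-1) = 1 is also covered. *)
Definition superfactorial (n : int) : nat :=
  if n is Posz m then \prod_(1 <= i < m.+1) i`! else 1%N.

Definition central_cell : cell := (0, 0).

(* Main.v *)
Require Import Defs.
From mathcomp Require Import all_boot all_order all_algebra.
From mathcomp Require Import finmap zify ring.

(** Let the squares [(i, j)] with [i + j] odd be called sites.  They form [2 k]
    diagonal rows of [2 k] sites, and between two consecutive rows lies a strip of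
    [2 k + 1] squares of the other colour.  The removed square is a site of one
    of the two middle rows, and by symmetry it may be taken to be [(1, 0)].

    Cut the region along the row [X] of [2 k - 1] sites that has lost a site.
    There are [k] strips on one side and [k - 1] on the other, so a tiling matches
    [k] sites of this row to one side and the rest to the other, and the count
    is the sum over [A] of [D_k A * D_(k-1) (X - A)], where [D_m A] counts the
    tilings of [m] strips of which the last row only keeps [A]
    ([region_tilings]).

    To find [D_m], follow the strips ([half_countS]).  The number of matchings of
    one strip between two sets of sites is found by scanning its columns
    ([perm_sum_strip_from]), and as an operator on exterior products of functions
    of the column it is
    [f_1 ^ ... ^ f_m |-> 2 * 1 ^ P f_1 ^ ... ^ P f_m] with
    [P f x = f x + 2 * (f 0 + ... + f (x - 1))] ([strip_wedges]).  As [P] maps the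
    binomial [C(x,j)] to [C(x,j) + 2 C(x,j+1)], the function [D_m] is
    [2 ^ (m (m + 1) / 2)] times the exterior product of [C(x,0)], ..., [C(x,m-1)]
    ([half_count_binom]), that is, a Vandermonde product over
    [0! 1! ... (m-1)!] ([binom_form_vandermonde]).

    It remains to sum [V A * V (X - A)] over [A], where [V] is the Vandermonde
    product.  This is a Laplace expansion up to signs, and the signs disappear when
    the rows of the second block are multiplied by [(-1)] to the position in [X].
    Adding and subtracting the two blocks then separates the even positions from
    the odd ones: the sum is [2 ^ (k - 1)] times the product of the values of [V]
    at the set of even and at the set of odd positions ([sum_wedges_parity]).
    Both sets are unions of two arithmetic progressions, because the removed
    site exchanges the two parities; the even differences come from pairs within a
    progression and the odd ones from pairs across, which gives the two products
    of the statement ([even_products], [odd_products]). *)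

Set Implicit Arguments.
Unset Strict Implicit.
Unset Printing Implicit Defensive.

Import Order.TTheory GRing.Theory Num.Theory.
Local Open Scope ring_scope.

(** * Tilings as perfect matchings *)

Lemma edge_adjacentC c c' : edge_adjacent c c' = edge_adjacent c' c.
Proof. by rewrite /edge_adjacent distrC [X in _ + X]distrC. Qed.

Lemma edge_adjacent_neq c c' : edge_adjacent c c' -> c != c'.
Proof. by apply: contraTneq => ->; rewrite /edge_adjacent !subrr. Qed.

(** The tilings of a subset [Y] of a fixed region [A]: recursion on the set of
    squares still to be covered stays inside one finite type. *)
Definition tilings (A : {fset cell}) (Y : {set A}) : {set {set {set A}}} :=
  [set T | partition T Y && [forall D in T, is_domino D]].

Lemma tilings0 (A : {fset cell}) : #|tilings (set0 : {set A})| = 1%N.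
Proof.
suff -> : tilings (set0 : {set A}) = [set set0] by rewrite cards1.
apply/setP => T; rewrite !inE partition_set0.
by case: eqP => // ->; apply/forall_inP => D; rewrite inE.
Qed.

Lemma dominoP (A : {fset cell}) (u : A) (D : {set A}) :
  u \in D -> is_domino D ->
  exists2 v : A, edge_adjacent (val u) (val v) & D = [set u; v].
Proof.
move=> uD /existsP[c /existsP[c' /andP[adj /eqP DE]]].
move: uD; rewrite DE !inE => /orP[] /eqP ->; first by exists c'.
by exists c; rewrite 1?edge_adjacentC // setUC.
Qed.

Lemma card_tilings_domino (A : {fset cell}) (Y : {set A}) (u v : A) :
    u \in Y -> v \in Y -> edge_adjacent (val u) (val v) ->
  #|[set T in tilings Y | [set u; v] \in T]| = #|tilings (Y :\ u :\ v)|.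
Proof.
move=> uY vY adj; set D := [set u; v]; set Y' := Y :\ u :\ v.
have uv : u != v by rewrite -val_eqE edge_adjacent_neq.
have Y'E : Y' = Y :\: D by rewrite /Y' setDDl.
have DY : D \subset Y by rewrite subUset !sub1set uY vY.
have D0 : D != set0 by apply/set0Pn; exists u; rewrite !inE eqxx.
have domD : is_domino D.
  by apply/existsP; exists u; apply/existsP; exists v; rewrite adj eqxx.
have DnT T : T \in tilings Y' -> D \notin T.
  rewrite inE => /andP[/and3P[/eqP cT _ _] _]; apply/negP => DT.
  have : u \in cover T by apply/bigcupP; exists D; rewrite // !inE eqxx.
  by rewrite cT !inE eqxx andbF.
rewrite -(card_in_imset (f := fun T => D |: T) (D := tilings Y')); last first.
  by move=> T T' /DnT hT /DnT hT' e; rewrite -(setU1K hT) e setU1K.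
congr #|pred_of_set _|; apply/setP => T; apply/idP/imsetP.
  rewrite !inE => /andP[/andP[pT /forall_inP domT] DT]; exists (T :\ D).
    rewrite inE Y'E partitionD1 //=; apply/forall_inP => E.
    by rewrite inE => /andP[_ /domT].
  by rewrite setD1K.
case=> T' hT' ->; move: (hT'); rewrite !inE eqxx /= andbT => /andP[pT' /forall_inP domT'].
apply/andP; split; last first.
  by apply/forall_inP => E; rewrite !inE => /orP[/eqP ->|/domT'].
have -> : Y = D :|: Y' by rewrite Y'E -[LHS](setID Y D) (setIidPr DY).
apply: partitionU1 => //; rewrite Y'E -setI_eq0.
by apply/eqP/setP => x; rewrite !in_set; case: (x \in Y); case: (_ || _).
Qed.

(** Every tiling contains exactly one domino [[set u; v]] through [u], so the
    tilings of [Y] are sorted by [v]. *)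
Lemma card_tilings_rec (A : {fset cell}) (Y : {set A}) (u : A) : u \in Y ->
  #|tilings Y| =
  (\sum_(v in Y | edge_adjacent (val u) (val v)) #|tilings (Y :\ u :\ v)|)%N.
Proof.
move=> uY.
transitivity (\sum_(T in tilings Y)
   \sum_(v in Y | edge_adjacent (val u) (val v)) ([set u; v] \in T : nat))%N.
  rewrite -sum1_card; apply: eq_bigr => T.
  rewrite inE => /andP[/and3P[/eqP cT tT _] /forall_inP domT].
  have uT : u \in cover T by rewrite cT.
  have [v adj DE] := dominoP (etrans (mem_pblock T u) uT) (domT _ (pblock_mem uT)).
  have DT : [set u; v] \in T by rewrite -DE pblock_mem.
  have vY : v \in Y by rewrite -cT; apply/bigcupP; exists [set u; v]; rewrite // !inE eqxx orbT.
  rewrite (bigD1 v) /= ?vY ?adj // DT big1 // => w /andP[/andP[wY adjw] wv].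
  case wT: ([set u; w] \in T) => //; have := def_pblock tT wT (_ : u \in [set u; w]).
  rewrite DE !inE eqxx => /(_ isT) /setP /(_ w); rewrite !inE eqxx orbT (negbTE wv) orbF.
  by move/eqP => wu; move: adjw => /edge_adjacent_neq; rewrite wu eqxx.
rewrite exchange_big; apply: eq_bigr => v /andP[vY adj].
rewrite -card_tilings_domino // -sum1_card big_mkcond [RHS]big_mkcond /=.
by apply: eq_bigr => T _; rewrite !inE; do 2!case: ifP => //=; case: (_ \in _).
Qed.

(** The permanent of the matrix of the values [f w], with one row for each [f]
    in [fs] and one column for each [w] in [X], expanded along its rows.  No
    order on the columns is needed, and it is [0] unless [#|X| = size fs]. *)
Fixpoint perm_sum (W : finType) (fs : seq (W -> nat)) (X : {set W}) : nat :=
  if fs is f :: fs' then (\sum_(w in X) f w * perm_sum fs' (X :\ w))%N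
  else X == set0.

(** The region is bipartite, with the classes [c2 us] and [c1 X].  Covering the
    squares [c2 i] one after the other, by the recursion above, is the expansion
    of the permanent of the adjacency matrix. *)
Lemma card_tilings_perm (A : {fset cell}) (W : finType) (I : eqType)
    (c1 : W -> cell) (c2 : I -> cell) (us : seq I) (X : {set W}) (Y : {set A}) :
    injective c1 -> injective c2 -> uniq us ->
    (forall w w', ~~ edge_adjacent (c1 w) (c1 w')) ->
    (forall i i', ~~ edge_adjacent (c2 i) (c2 i')) ->
    (forall i w, c2 i != c1 w) ->
    {subset map c2 us <= A} -> {in X, forall w, c1 w \in A} ->
    (forall v : A, (v \in Y) =
       (val v \in map c2 us) || [exists w in X, val v == c1 w]) ->
  #|tilings Y| =
  perm_sum [seq (fun w => edge_adjacent (c2 i) (c1 w) : nat) | i <- us] X.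
Proof.
move=> inj1 inj2 + adj1 adj2 adj12 + + .
elim: us X Y => [|i us IH] X Y /=.
  move=> _ _ XA YE; have [X0|[w wX]] := set_0Vmem X.
    rewrite X0 eqxx (_ : Y = set0) ?tilings0 //; apply/setP => v.
    rewrite in_set0 YE /=; apply/existsP => -[w].
    by rewrite X0 inE.
  have vY : [` XA _ wX]%fset \in Y.
    by rewrite YE; apply/existsP; exists w; rewrite wX /=.
  have /negPf -> : X != set0 by apply/set0Pn; exists w.
  rewrite (card_tilings_rec vY) big1 //.
  move=> v /andP[]; rewrite YE /= => /existsP[w' /andP[_ /eqP vE]].
  by rewrite vE (negPf (adj1 _ _)).
move=> /andP[ius uniq_us] usA XA YE.
have iA : c2 i \in A by apply: usA; rewrite inE eqxx.
have uY : [` iA]%fset \in Y by rewrite YE inE eqxx.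
rewrite (card_tilings_rec uY).
rewrite [RHS](eq_bigr (fun w => if edge_adjacent (c2 i) (c1 w) then
   perm_sum [seq (fun w0 => edge_adjacent (c2 i) (c1 w0) : nat) | i <- us] (X :\ w)
   else 0%N)); last by move=> w _; case: edge_adjacent; rewrite ?mul1n ?mul0n.
rewrite -big_mkcondr /=.
pose g (w : W) : A := insubd [` iA]%fset (c1 w).
have gE w : w \in X -> val (g w) = c1 w.
  by move=> wX; rewrite /g val_insubd XA.
rewrite [RHS](eq_bigr (fun w => #|tilings (Y :\ [` iA]%fset :\ g w)|)); last first.
  move=> w /andP[wX adj]; apply/esym/IH => //.
  - by move=> c cus; apply: usA; rewrite inE cus orbT.
  - by move=> w'; rewrite inE => /andP[_ /XA].
  move=> v; rewrite !inE YE inE -!val_eqE /= gE //.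
  have [->|vi] := eqVneq (val v) (c2 i).
    rewrite andbF (mem_map inj2) (negPf ius) /=; apply/esym/existsP => -[w'].
    by rewrite (negPf (adj12 _ _)) andbF.
  have [->|vw] /= := eqVneq (val v) (c1 w).
    apply/esym/norP; split.
      by apply/mapP => -[j _ /esym/eqP]; rewrite (negPf (adj12 _ _)).
    by apply/existsP => -[w']; rewrite !inE (inj_eq inj1) eq_sym => /andP[/andP[/negPf->]].
  congr orb; apply: eq_existsb => w'; rewrite !inE.
  by have [->|//] := eqVneq w' w; rewrite (negPf vw) !andbF.
rewrite -(big_imset (h := g) (A := [pred w in X | edge_adjacent (c2 i) (c1 w)]) 
   (fun v => #|tilings (Y :\ [` iA]%fset :\ v)|)) /=; last first.
  move=> w w' /andP[wX _] /andP[w'X _] /(congr1 val).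
  by rewrite !gE // => /inj1.
apply: eq_bigl => v; apply/idP/imsetP => [|[w /andP[wX adj] ->]].
  rewrite YE inE => /andP[/orP[/orP[/eqP ->|]|]].
  - by rewrite (negPf (adj2 _ _)).
  - by case/mapP => j _ ->; rewrite (negPf (adj2 _ _)).
  case/existsP => w /andP[wX /eqP vE]; rewrite vE => adj; exists w.
    by rewrite inE wX.
  by apply/val_inj; rewrite /= gE.
rewrite [val _]gE // adj andbT YE; apply/orP; right; apply/existsP; exists w.
by rewrite wX; apply/eqP/gE.
Qed.

(** Laplace expansion along a block of rows; permanents carry no signs. *)
Lemma perm_sum_cat (W : finType) (fs hs : seq (W -> nat)) (X : {set W}) :
  perm_sum (fs ++ hs) X =
  (\sum_(A : {set W} | A \subset X) perm_sum fs A * perm_sum hs (X :\: A))%N.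
Proof.
elim: fs X => [|f fs IH] X /=.
  rewrite (bigD1 set0) ?sub0set //= eqxx mul1n setD0 big1 ?addn0 // => A /andP[_].
  by move/negPf->.
under [RHS]eq_bigr do rewrite big_distrl.
rewrite (exchange_big_dep (mem X)) /=; last by move=> A w /subsetP h /h.
apply: eq_bigr => w wX; rewrite IH big_distrr /=.
rewrite [RHS](reindex_onto (fun A => w |: A) (fun A => A :\ w)) /=; last first.
  by move=> A /andP[_ wA]; rewrite setD1K.
have memE (A : {set W}) : (w |: A \subset X) && (w \in w |: A) && ((w |: A) :\ w == A) =
                          (A \subset X :\ w).
  rewrite subsetD1 subUset sub1set wX setU11 andbT /=; congr (_ && _).
  by apply/eqP/idP => [<-|/setU1K//]; rewrite !inE eqxx.
apply: eq_big => [A|A]; first by rewrite memE.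
rewrite -memE => /andP[_ /eqP ->]; rewrite mulnA; congr (_ * perm_sum hs _)%N.
by rewrite setDDl.
Qed.

Lemma perm_sum_eq0 (W : finType) (fs : seq (W -> nat)) (X : {set W}) (w : W) :
  w \in X -> all (fun f => f w == 0)%N fs -> perm_sum fs X = 0%N.
Proof.
elim: fs X => [|f fs IH] X wX /=; first by case: eqP wX => // ->; rewrite inE.
move=> /andP[/eqP fw fsw]; rewrite big1 // => v vX.
have [->|vw] := eqVneq v w; first by rewrite fw.
by rewrite IH ?muln0 // !inE eq_sym vw.
Qed.

Lemma perm_sum_imset (W W' : finType) (h : W -> W') (fs : seq (W' -> nat))
    (X : {set W}) :
  injective h -> perm_sum fs (h @: X) = perm_sum [seq f \o h | f <- fs] X.
Proof.
move=> inj_h; elim: fs X => [|f fs IH] X /=; first by rewrite imset_eq0.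
rewrite big_imset /=; last by move=> x y _ _ /inj_h.
apply: eq_bigr => w wX; rewrite -IH; congr (_ * perm_sum _ _)%N.
apply/setP => w'; rewrite !inE; apply/andP/imsetP => [[ne /imsetP[v vX vE]]|[v]].
  by exists v => //; rewrite !inE vX andbT; apply: contra_neq ne => <-.
rewrite !inE => /andP[ne vX] ->; rewrite (inj_eq inj_h) ne; split=> //.
by apply/imsetP; exists v.
Qed.

Lemma eq_perm_sum (W : finType) (I : eqType) (s : seq I) (F G : I -> W -> nat)
    (X : {set W}) :
  {in s, forall i, F i =1 G i} ->
  perm_sum [seq F i | i <- s] X = perm_sum [seq G i | i <- s] X.
Proof.
elim: s X => [|i s IH] X //= e; apply: eq_bigr => w _.
rewrite e ?mem_head // IH // => j js; apply: e; by rewrite inE js orbT.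
Qed.

(** * One strip: a row of squares between two rows of sites *)

Section Strip.
Variables (N n : nat).
Notation site := ('I_N.+1 * 'I_n)%type.

Definition row_of (w : site) : nat := w.1.
Definition col_of (w : site) : nat := w.2.

Lemma row_lt w : (row_of w < N.+1)%N. Proof. exact: ltn_ord. Qed.

Lemma col_lt w : (col_of w < n)%N. Proof. exact: ltn_ord. Qed.

(** Square [p] of strip [r] touches the sites of rows [r] and [r + 1] in the
    columns [p - 1] and [p]; there are [n] columns and [n + 1] squares. *)
Definition square_nbr (r p : nat) (w : site) : nat :=
  ((row_of w == r) || (row_of w == r.+1)) &&
  ((col_of w == p) || ((col_of w).+1 == p)).

Definition row_nbrs (r : nat) : seq (site -> nat) :=
  [seq square_nbr r p | p <- iota 0 n.+1].

(** Matchings of a strip, scanned by columns: [g] sites are still unmatched in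
    the column just passed and [ds] counts the sites in the next ones.  The
    square between them is the last one to touch the column just passed: it has
    to take the unmatched site if [g = 1], it takes one of the [d] sites of the
    next column if [g = 0], and [g >= 2] is hopeless.  The last square has no
    next column, hence the value at [[::]]. *)
Fixpoint strip (g : nat) (ds : seq nat) : nat :=
  if ds is d :: ds' then
    if g is 0 then (d * strip d.-1 ds')%N else if g is 1 then strip d ds' else 0%N
  else g == 1%N.

(** The shift of the index leaves room for an empty column before the first
    square, at [i = 0]. *)
Definition col_count (Y : {set site}) (i : nat) : nat :=
  #|[set w in Y | (col_of w).+1 == i]|.

Lemma col_countD1 (Y : {set site}) (w : site) (i : nat) : w \in Y ->
  col_count (Y :\ w) i = (col_count Y i - ((col_of w).+1 == i))%N.
Proof.
move=> wY; rewrite /col_count.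
have -> : [set w0 in Y :\ w | (col_of w0).+1 == i] = [set w0 in Y | (col_of w0).+1 == i] :\ w.
  by apply/setP => x; rewrite !inE andbA.
by rewrite [in RHS](cardsD1 w) inE wY addKn.
Qed.

(** The number of matchings of a strip only depends on how many of its two
    sites survive in each column. *)
Lemma perm_sum_strip_from (r i m : nat) (Y : {set site}) :
    (i + m = n)%N ->
    {in Y, forall w : site, (row_of w == r) || (row_of w == r.+1)} ->
    {in Y, forall w : site, (i <= (col_of w).+1)%N} ->
  perm_sum [seq square_nbr r p | p <- iota i m.+1] Y =
  strip (col_count Y i) [seq col_count Y j | j <- iota i.+1 m].
Proof.
elim: m i Y => [|m IH] i Y im Yr Yi.
  have Yall (w : site) : w \in Y -> (col_of w).+1 == i.
    move=> wY; have := Yi w wY; have := col_lt w. lia.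
  have cE : col_count Y i = #|Y|.
    by congr #|pred_of_set _|; apply/setP => w; rewrite inE andb_idr // => /Yall.
  have -> : perm_sum [seq square_nbr r p | p <- iota i 1] Y =
            (\sum_(w in Y) (#|Y :\ w| == 0))%N.
    rewrite /=; apply: eq_bigr => w wY.
    by rewrite /square_nbr Yr // Yall // orbT mul1n cards_eq0.
  rewrite /= cE (eq_bigr (fun _ => (#|Y|.-1 == 0)%N : nat)); last first.
    by move=> w wY; rewrite [in RHS](cardsD1 w) wY.
  by rewrite sum_nat_const; case: #|Y| => [|[|k]] //=; rewrite muln0.
have -> : perm_sum [seq square_nbr r p | p <- iota i m.+2] Y =
  (\sum_(w in Y | (col_of w == i) || ((col_of w).+1 == i))
     perm_sum [seq square_nbr r p | p <- iota i.+1 m.+1] (Y :\ w))%N.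
  rewrite [LHS]/= -/(iota i.+1 m.+1) big_mkcondr; apply: eq_bigr => w wY.
  by rewrite /square_nbr Yr //=; case: ifP => _; rewrite ?mul1n ?mul0n.
pose Y1 := [set w in Y | (col_of w).+1 == i].
have stuck (w v : site) : w \in Y -> v \in Y1 -> v != w ->
    perm_sum [seq square_nbr r p | p <- iota i.+1 m.+1] (Y :\ w) = 0%N.
  rewrite inE => wY /andP[vY /eqP vi] vw.
  apply: (perm_sum_eq0 (w := v)); first by rewrite !inE vw vY.
  rewrite all_map; apply/allP => p; rewrite mem_iota => pI.
  rewrite /= /square_nbr Yr //= eqb0; lia.
have step (w : site) : w \in Y -> (col_of w == i) || ((col_of w).+1 == i) ->
    (forall v, v \in Y1 -> v = w) ->
    perm_sum [seq square_nbr r p | p <- iota i.+1 m.+1] (Y :\ w) =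
    strip (col_count Y i.+1 - (col_of w == i)) [seq col_count Y j | j <- iota i.+2 m].
  move=> wY wi Y1w; rewrite IH; first last.
  - move=> v; rewrite !inE => /andP[vw vY]; have := Yi v vY.
    rewrite leq_eqVlt => /orP[/eqP vi|//].
    by case/eqP: vw; apply: Y1w; rewrite inE vY vi eqxx.
  - by move=> v; rewrite inE => /andP[_ /Yr].
  - by lia.
  rewrite col_countD1 // eqSS; congr strip; apply/eq_in_map => j.
  by rewrite mem_iota => jI; rewrite col_countD1 //; case/orP: wi => /eqP wi; lia.
have c1 : col_count Y i = #|Y1| by [].
rewrite [RHS]/= c1; case E : #|Y1| => [|[|k]].
- move/eqP: E; rewrite cards_eq0 => /eqP Y10.
  rewrite (eq_bigr (fun _ => strip (col_count Y i.+1).-1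
             [seq col_count Y j | j <- iota i.+2 m])); last first.
    move=> w /andP[wY wi]; rewrite step //; last by move=> v; rewrite Y10 inE.
    have wi' : (col_of w == i).
      case/orP: wi => // wi; have : w \in Y1 by rewrite inE wY wi.
      by rewrite Y10 inE.
    by rewrite wi' subn1.
  rewrite sum_nat_const; congr (_ * _)%N; rewrite /col_count cardsE /=.
  apply: eq_card => w; rewrite -!topredE /= eqSS; case wY: (w \in Y) => //=.
  case wi: ((col_of w).+1 == i); last by rewrite orbF.
  have : w \in Y1 by rewrite inE wY wi.
  by rewrite Y10 inE.
- move/eqP: E => /cards1P[w0 Y1E].
  have : w0 \in Y1 by rewrite Y1E inE.
  rewrite inE => /andP[w0Y w0i].
  rewrite (bigD1 w0); last by rewrite w0Y w0i orbT.
  rewrite step //; first last.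
  - by move=> v; rewrite Y1E inE => /eqP.
  - by rewrite w0i orbT.
  rewrite big1 => [|w /andP[/andP[wY _] ww0]]; last first.
    by apply: (stuck w w0); rewrite // ?Y1E ?inE // eq_sym.
  by rewrite (_ : (col_of w0 == i) = false) ?subn0 /= ?addn0 //; lia.
- rewrite big1 // => w /andP[wY _].
  have [v] : exists v, v \in Y1 :\ w.
    by apply/set0Pn; rewrite -card_gt0; have := cardsD1 w Y1; rewrite E; lia.
  by rewrite !inE => /andP[vw vY1]; apply: (stuck w v); rewrite // inE.
Qed.

(** * Cutting the region along rows *)

Definition squares (rs : seq nat) : seq (nat * nat) :=
  [seq (r, p) | r <- rs, p <- iota 0 n.+1].

Definition nbr (i : nat * nat) : site -> nat := square_nbr i.1 i.2.

Lemma map_nbr_squares1 r : [seq nbr i | i <- squares [:: r]] = row_nbrs r.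
Proof. by rewrite /squares /= cats0 -map_comp. Qed.

Lemma nbr_squares_row rs w :
  (forall r, r \in rs -> (row_of w != r) && (row_of w != r.+1)) ->
  all (fun f => f w == 0)%N [seq nbr i | i <- squares rs].
Proof.
move=> h; rewrite all_map; apply/allP => _ /allpairsP[[r p] [/h rr _ ->]] /=.
by case/andP: rr => rr rr1; rewrite /nbr /square_nbr /= (negPf rr) (negPf rr1).
Qed.

(** All the sites strictly below row [m] together with the sites [B] of row [m];
    [over] is its mirror image. *)
Definition under (m : nat) (B : {set 'I_n}) : {set site} :=
  [set w : site | (row_of w < m)%N || ((row_of w == m) && (w.2 \in B))].

Definition over (m : nat) (B : {set 'I_n}) : {set site} :=
  [set w : site | (m < row_of w)%N || ((row_of w == m) && (w.2 \in B))].

(** If [F Y] vanishes unless [Y] contains every site below row [m] and none above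
    it, only the part of [Y] in row [m] is free. *)
Lemma sum_under (m : nat) (X : {set site}) (F : {set site} -> nat) :
    (m <= N)%N ->
    (forall w, (row_of w < m)%N -> w \in X) ->
    (forall (Y : {set site}) w, Y \subset X -> w \in Y -> (m < row_of w)%N -> F Y = 0%N) ->
    (forall (Y : {set site}) w, Y \subset X -> w \notin Y -> (row_of w < m)%N -> F Y = 0%N) ->
  (\sum_(Y : {set site} | Y \subset X) F Y =
   \sum_(B : {set 'I_n} | under m B \subset X) F (under m B))%N.
Proof.
move=> mN Xlow Fhigh Flow.
pose slice (Y : {set site}) := [set p : 'I_n | (inord m, p) \in Y].
have sliceK B : slice (under m B) = B.
  by apply/setP => p; rewrite !inE /row_of /= inordK // ltnn eqxx.
rewrite (bigID (fun Y => under m (slice Y) == Y)) /= [X in (_ + X)%N]big1 ?addn0.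
  rewrite (reindex_onto (under m) slice) /=; last by move=> Y /andP[_ /eqP].
  apply: eq_bigl => B; rewrite sliceK eqxx !andbT.
  by rewrite eqxx andbT.
move=> Y /andP[YX ne].
case: (boolP [exists w in Y, (m < row_of w)%N]) => [/existsP[w /andP[wY mw]]|/existsPn hi].
  exact: Fhigh wY mw.
case: (boolP [exists w, (w \notin Y) && (row_of w < m)%N]) => [/existsP[w /andP[wY mw]]|/existsPn lo].
  exact: Flow wY mw.
case/eqP: ne; apply/setP => w; rewrite !inE.
have := hi w; have := lo w; rewrite !negb_and negbK -!leqNgt.
case: (ltngtP (row_of w) m) => //=.
- by move=> _; rewrite orbF => -> .
- by move=> _ _; rewrite orbF => /negPf.
move=> rw _ _; suff -> : (inord m, w.2) = w by [].
by case: w rw => a b /= <-; rewrite /row_of /= inord_val.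
Qed.

(** [A] is the set of sites of the upper row present in a strip, and [B] the set
    of sites of its lower row that are left to the strip below. *)
Definition strip_counts (A B : {set 'I_n}) : seq nat :=
  [seq ((p \in A) + (p \notin B))%N | p <- enum 'I_n].

Lemma perm_sum_row (m : nat) (A B : {set 'I_n}) : (m < N)%N ->
  perm_sum (row_nbrs m) (under m.+1 A :\: under m B) = strip 0 (strip_counts A B).
Proof.
move=> mN; set Y := _ :\: _.
have YE w : (w \in Y) = ((row_of w == m) && (w.2 \notin B)) || ((row_of w == m.+1) && (w.2 \in A)).
  rewrite !inE ltnS; case: (ltngtP (row_of w) m) => //= h.
  - by rewrite (_ : (row_of w == m.+1) = false) //; lia.
  - by rewrite h (_ : (m == m.+1) = false) ?orbF ?andbT //; lia.
clearbody Y; rewrite (@perm_sum_strip_from m 0 n) //; first last.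
  by move=> w; rewrite YE => /orP[] /andP[/eqP-> _]; rewrite eqxx ?orbT.
have -> : col_count Y 0 = 0%N.
  by apply: eq_card0 => w; rewrite !inE andbF.
congr strip; rewrite /strip_counts (iotaDl 1 0) -val_enum_ord -!map_comp.
apply: eq_map => p /=; rewrite add1n /col_count.
have -> : [set w in Y | (col_of w).+1 == p.+1] =
   [set w in Y | w == (inord m.+1, p)] :|: [set w in Y | w == (inord m, p)].
  apply/setP => -[a b]; rewrite !in_set -andb_orr; case wY: (_ \in Y) => //=.
  rewrite /col_of /= eqSS !xpair_eqE val_eqE -andb_orl andb_idl // => _.
  move: wY; rewrite YE /row_of /= => /orP[] /andP[/eqP h _].
    by rewrite -h inord_val eqxx orbT.
  by rewrite -h inord_val eqxx.
have card1 w : #|[set w' in Y | w' == w]| = (w \in Y).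
  case wY: (w \in Y); last first.
    by apply: eq_card0 => w'; rewrite !inE; case: eqP => [->|]; rewrite ?wY ?andbF.
  by apply/eqP/cards1P; exists w; apply/setP => w'; rewrite !inE; case: eqP => [->|]; rewrite ?wY ?andbF.
have mm : (m.+1 == m) = false by rewrite eqn_leq ltnn.
have mN1 : (m < N.+1)%N by apply: ltnW.
rewrite cardsU !card1 !YE /row_of /= !inordK // !eqxx [m == _]eq_sym mm /= orbF.
rewrite (_ : _ :&: _ = set0) ?cards0 ?subn0 //.
apply/setP => w; rewrite !inE; apply/negP => /andP[/andP[_ /eqP->] /andP[_]].
by rewrite xpair_eqE -val_eqE /= !inordK // mm.
Qed.

(** Matchings of the first [m] strips when only the sites [B] of row [m] are
    present. *)
Definition half_count (m : nat) (B : {set 'I_n}) : nat :=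
  perm_sum [seq nbr i | i <- squares (iota 0 m)] (under m B).

Lemma half_count0 B : half_count 0 B = (B == set0).
Proof.
rewrite /half_count /=; congr nat_of_bool; apply/eqP/eqP => [h|->].
  apply/setP => p; have /setP/(_ (ord0, p)) := h.
  by rewrite !inE.
by apply/setP => w; rewrite !inE andbF.
Qed.

Lemma squares_cat rs rs' : squares (rs ++ rs') = squares rs ++ squares rs'.
Proof. by rewrite /squares allpairs_cat. Qed.

Lemma half_countS (m : nat) (A : {set 'I_n}) : (m < N)%N ->
  half_count m.+1 A =
  (\sum_(B : {set 'I_n}) strip 0 (strip_counts A B) * half_count m B)%N.
Proof.
move=> mN; rewrite /half_count -[in iota 0 m.+1]addn1 iotaD squares_cat map_cat.
rewrite map_nbr_squares1 perm_sum_cat (@sum_under m) //; first last.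
- move=> Y w YX wY wm; rewrite [X in (_ * X)%N](perm_sum_eq0 (w := w)) ?muln0 //.
    by rewrite !inE wY (_ : row_of w < m.+1)%N //; lia.
  rewrite -map_nbr_squares1; apply: nbr_squares_row => r; rewrite inE => /eqP ->; lia.
- move=> Y w YX wY wm; rewrite (perm_sum_eq0 (w := w)) ?mul0n //.
  by apply: nbr_squares_row => r; rewrite mem_iota; lia.
- by move=> w wm; rewrite inE; lia.
- exact: ltnW.
apply: eq_big => [B|B _]; last by rewrite perm_sum_row // mulnC.
by apply/subsetP => w; rewrite !inE => h; apply/orP; left; case/orP: h; lia.
Qed.

(** Turning the rows upside down exchanges the two ends of the region. *)
Lemma half_count_over (m : nat) (B : {set 'I_n}) : (m <= N)%N ->
  perm_sum [seq nbr i | i <- squares [seq (N.-1 - r)%N | r <- iota 0 m]] (over (N - m) B)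
  = half_count m B.
Proof.
move=> mN; pose flip (w : site) : site := (rev_ord w.1, w.2).
have flip_inj : injective flip.
  move=> [a b] [c d] e; have /rev_ord_inj /= -> := congr1 fst e.
  by have /= -> := congr1 snd e.
have row_flip w : row_of (flip w) = (N - row_of w)%N by rewrite /row_of /= subSS.
have -> : over (N - m) B = flip @: under m B.
  apply/setP => w; have -> : w = flip (flip w) by case: w => a b; rewrite /flip /= rev_ordK.
  rewrite (mem_imset _ _ flip_inj); move: (flip w) => {}w.
  have wN : (row_of w <= N)%N by rewrite -ltnS; apply: row_lt.
  rewrite !inE row_flip; have -> : (N - m < N - row_of w)%N = (row_of w < m)%N by lia.
  by have -> : (N - row_of w == N - m)%N = (row_of w == m) by lia.
rewrite perm_sum_imset // /half_count -map_comp.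
have -> : squares [seq (N.-1 - r)%N | r <- iota 0 m] =
          [seq ((N.-1 - i.1)%N, i.2) | i <- squares (iota 0 m)].
  by rewrite /squares map_allpairs allpairs_mapl.
rewrite -map_comp; apply: eq_perm_sum => -[r p] /allpairsP[[r' p'] /= [+ _ [-> ->]]].
rewrite mem_iota => rm [a b]; rewrite /nbr /square_nbr /row_of /col_of /= subSS.
have aN : (a <= N)%N by rewrite -ltnS.
move: (nat_of_ord a) aN => {}a aN.
have -> : (N - a == N.-1 - r')%N = (a == r'.+1) by lia.
have -> : (N - a == (N.-1 - r').+1)%N = (a == r') by lia.
by rewrite orbC.
Qed.

(** Row [m], of which only the sites [D] are present, separates the strips below
    it from those above it: the sites [B] are matched downwards and the others
    upwards. *)
Lemma perm_sum_cut (m l : nat) (D : {set 'I_n}) : (m + l = N)%N ->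
  perm_sum [seq nbr i | i <- squares (iota 0 m ++ [seq (N.-1 - r)%N | r <- iota 0 l])]
    [set w : site | (row_of w == m) ==> (w.2 \in D)] =
  (\sum_(B : {set 'I_n} | B \subset D) half_count m B * half_count l (D :\: B))%N.
Proof.
move=> mlN; set X := [set w : site | _].
rewrite squares_cat map_cat perm_sum_cat (@sum_under m) //; first last.
- move=> Y w YX wY wm; rewrite [X in (_ * X)%N](perm_sum_eq0 (w := w)) ?muln0 //.
    by rewrite !inE wY; lia.
  by apply: nbr_squares_row => r /mapP[r']; rewrite mem_iota; lia.
- move=> Y w YX wY wm; rewrite (perm_sum_eq0 (w := w)) ?mul0n //.
  by apply: nbr_squares_row => r; rewrite mem_iota; lia.
- by move=> w wm; rewrite inE; lia.
- lia.
have subE B : (under m B \subset X) = (B \subset D).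
  apply/subsetP/subsetP => [h p pB|h w].
    have := h (inord m, p); rewrite !inE /row_of /= inordK ?eqxx ?ltnn /=; last lia.
    exact.
  rewrite !inE; case: eqP => [->|] //=; rewrite ltnn /=; exact: h.
apply: eq_big => [B|B]; first exact: subE.
move=> _; congr (_ * _)%N; rewrite -half_count_over; last lia.
congr perm_sum; apply/setP => w; rewrite !inE (_ : (N - l)%N = m); last lia.
by case: (ltngtP (row_of w) m); rewrite ?andbF ?andbT.
Qed.

End Strip.

(** * Exterior forms on the columns *)

Section Exterior.
Variables (R : numFieldType) (n : nat).
Notation vec := {ffun 'I_n -> R^o}.
Notation form := {ffun {set 'I_n} -> R^o}.

(** A [form] is an element of the exterior algebra of the functions on the
    columns, given by its coefficient at each set of columns; the coefficient at
    [X] of [f_1 ^ ... ^ f_m] is the determinant of the values of the [f_i] at the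
    elements of [X] in increasing order. *)
Definition below (i : nat) (X : {set 'I_n}) : nat := #|[set x in X | (x < i)%N]|.

Lemma belowD1 i (X : {set 'I_n}) (a : 'I_n) : a \in X ->
  below i X = ((a < i) + below i (X :\ a))%N.
Proof.
move=> aX; rewrite /below (cardsD1 a) inE aX; congr (_ + _)%N.
by congr #|pred_of_set _|; apply/setP => x; rewrite !inE andbA.
Qed.

Lemma belowU1 i (X : {set 'I_n}) (a : 'I_n) : a \notin X ->
  below i (a |: X) = ((a < i) + below i X)%N.
Proof. by move=> aX; rewrite (belowD1 _ (setU11 a X)) setU1K. Qed.

Definition wedge (f : vec) (w : form) : form :=
  [ffun X : {set 'I_n} => \sum_(a in X) (-1) ^+ below a X * f a * w (X :\ a)].

Definition form1 : form := [ffun X : {set 'I_n} => (X == set0)%:R].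

Definition wedges (fs : seq vec) (w : form) : form := foldr wedge w fs.

(** Interior product with the evaluation at column [i]. *)
Definition contract (i : 'I_n) (w : form) : form :=
  [ffun X : {set 'I_n} => if i \in X then 0 else (-1) ^+ below i X * w (i |: X)].

Lemma wedgeDl f g w : wedge (f + g) w = wedge f w + wedge g w.
Proof.
apply/ffunP => X; rewrite !ffunE -big_split; apply: eq_bigr => a _.
by rewrite ffunE mulrDr mulrDl.
Qed.

Lemma wedgeZl c f w : wedge (c *: f) w = c *: wedge f w.
Proof.
apply/ffunP => X; rewrite !ffunE scaler_sumr; apply: eq_bigr => a _.
by rewrite !ffunE /GRing.scale /=; ring.
Qed.

Lemma wedgeDr f w w' : wedge f (w + w') = wedge f w + wedge f w'.
Proof.
apply/ffunP => X; rewrite !ffunE -big_split; apply: eq_bigr => a _.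
by rewrite ffunE mulrDr.
Qed.

Lemma wedgeZr c f w : wedge f (c *: w) = c *: wedge f w.
Proof.
apply/ffunP => X; rewrite !ffunE scaler_sumr; apply: eq_bigr => a _.
by rewrite !ffunE /GRing.scale /=; ring.
Qed.

Lemma wedgeC f g w : wedge f (wedge g w) = - wedge g (wedge f w).
Proof.
have E f' g' (X : {set 'I_n}) : wedge f' (wedge g' w) X =
    \sum_(a in X) \sum_(b in X | b != a)
      (-1) ^+ (below a X + below b (X :\ a)) * (f' a * g' b * w (X :\ a :\ b)).
  rewrite ffunE; apply: eq_bigr => a _; rewrite ffunE mulr_sumr.
  apply: eq_big => [b|b _]; first by rewrite !inE andbC.
  by rewrite exprD; ring.
apply/ffunP => X; rewrite [RHS]ffunE !E -sumrN.
rewrite (exchange_big_dep (mem X)) /=; last by move=> a b _ /andP[].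
apply: eq_bigr => b bX; rewrite -sumrN; apply: eq_big => [a|a].
  by rewrite bX eq_sym.
move=> /andP[aX /andP[_ ba]]; rewrite setDDl setUC -setDDl.
rewrite (belowD1 a bX) (belowD1 b aX) !exprD.
have : (a != b :> nat) by rewrite eq_sym.
case: ltngtP => // _ _; rewrite ?expr0 ?expr1; ring.
Qed.

Lemma wedge_sq f w : wedge f (wedge f w) = 0.
Proof.
have /eqP := wedgeC f f w; rewrite -addr_eq0 -mulr2n -(scaler_nat 2).
by rewrite scaler_eq0 pnatr_eq0 => /eqP.
Qed.

(** Interior products are antiderivations. *)
Lemma contract_wedge i f w :
  contract i (wedge f w) = f i *: w - wedge f (contract i w).
Proof.
apply/ffunP => X; rewrite !ffunE.
case: ifP => iX.
  rewrite (bigD1 i) //= big1 ?addr0 => [|a /andP[aX ai]]; last first.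
    by rewrite ffunE !inE eq_sym ai iX mulr0.
  rewrite ffunE !inE eqxx /= setD1K // (belowD1 i iX) ltnn add0n.
  have cancel (s x y : R) : s ^+ 2 = 1 -> 0 = x * y - s * x * (s * y).
    by move=> s2; rewrite mulrACA -expr2 s2 mul1r subrr.
  exact: (cancel _ (f i) (w X) (sqrr_sign R (below i (X :\ i)))).
have niX : i \notin X by rewrite iX.
rewrite mulr_sumr (bigD1 i) ?setU11 //= setU1K // belowU1 // ltnn add0n.
rewrite 2!mulrA -expr2 sqrr_sign mul1r; congr (_ + _).
rewrite -sumrN; apply: eq_big => [a|a].
  by rewrite !inE; case: eqVneq => [->|_]; rewrite ?iX ?andbT.
rewrite !inE => /andP[/orP[/eqP->|aX] ai]; first by rewrite eqxx in ai.
rewrite ffunE !inE iX andbF belowU1 // (belowD1 i aX).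
rewrite setDUl (_ : [set i] :\ a = [set i]); last first.
  by apply/setP => x; rewrite !inE; case: (x =P i) => [->|]; rewrite ?andbF // eq_sym ai.
rewrite !exprD; have : (a != i :> nat) by [].
case: ltngtP => // _ _; rewrite ?expr0 ?expr1; ring.
Qed.

Lemma contract0 i (w : form) : (forall X : {set 'I_n}, i \in X -> w X = 0) -> contract i w = 0.
Proof. by move=> h; apply/ffunP => X; rewrite !ffunE; case: ifP => // _; rewrite h ?mulr0 ?setU11. Qed.

Lemma contract_form1 i : contract i form1 = 0.
Proof.
apply: contract0 => X iX; rewrite ffunE.
by case: eqP iX => // ->; rewrite inE.
Qed.

(** When each factor [f] is replaced by [f + c f(i) u], the terms with [u] in two
    places vanish, and those with a single [u] add up to the derivation
    [w |-> c u ^ contract i w]. *)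
Lemma wedges_shear (i : 'I_n) (u : vec) (c : R) (fs : seq vec) : u i = 0 ->
  wedges [seq f + (c * f i) *: u | f : vec <- fs] form1 =
  wedges fs form1 + c *: wedge u (contract i (wedges fs form1)).
Proof.
move=> ui; elim: fs => [|f fs /= ->].
  by rewrite /= contract_form1 /wedge; apply/ffunP => X; rewrite !ffunE big1 ?scaler0 ?addr0 // => a _; rewrite ffunE mulr0.
rewrite !wedgeDl !wedgeDr !wedgeZl !wedgeZr wedge_sq !scaler0 addr0 contract_wedge.
rewrite [wedge f (wedge u _)]wedgeC wedgeDr wedgeZr -[- wedge f _]scaleN1r wedgeZr.
rewrite !scalerDr !scalerA scalerN -!addrA; congr (_ + _).
by rewrite addrC mulrN1 scaleNr; congr (_ + _); rewrite mulrC.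
Qed.

(** * The strip as an operator on exterior forms *)

(** The image of a factor under the columns from [i] on of a strip; for [i = 0]
    it is the function whose difference at [x] is [f x + f (x + 1)] and whose
    value at [0] is [f 0]. *)
Definition ramp (i : nat) (f : vec) : vec :=
  [ffun x : 'I_n => f x + 2 * \sum_(b < n | (i <= b < x)%N) f b].

Definition tail_ind (i : nat) : vec := [ffun x : 'I_n => (i <= x)%N%:R].

Definition agree (i : nat) (B X : {set 'I_n}) : bool :=
  [forall b : 'I_n, (b < i)%N ==> ((b \in B) == (b \in X))].

(** The sum of [strip] against [w] when only the columns from [i] on have been
    scanned, with [g] unmatched sites in column [i - 1]: in the columns before
    [i], the set [X] still describes the lower row. *)
Definition partial_strip (w : form) (i g : nat) (X : {set 'I_n}) : R :=
  \sum_(B : {set 'I_n} | agree i B X)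
    (strip g [seq ((p \in X) + (p \notin B))%N | p <- drop i (enum 'I_n)])%:R * w B.

Lemma agreeS (o : 'I_n) (B X : {set 'I_n}) :
  agree o.+1 B X = agree o B X && ((o \in B) == (o \in X)).
Proof.
apply/forallP/andP => [h|[/forallP h /eqP e] b].
  split; last by have := h o; rewrite ltnS leqnn.
  by apply/forallP => b; apply/implyP => bo; have := h b; rewrite ltnS ltnW.
apply/implyP; rewrite ltnS leq_eqVlt => /orP[/eqP/val_inj->|bo]; first by rewrite e.
exact: (implyP (h b)).
Qed.

Lemma agree_eq (i : nat) (B X Y : {set 'I_n}) :
  (forall b : 'I_n, (b < i)%N -> (b \in X) = (b \in Y)) -> agree i B X = agree i B Y.
Proof. by move=> h; apply: eq_forallb => b; case: ltnP => //= /h ->. Qed.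

(** The lower row may or may not keep the site of column [o]. *)
Lemma partial_strip_rec (w : form) (o : 'I_n) (g : nat) (X : {set 'I_n}) :
  partial_strip w o g X =
  \sum_(B : {set 'I_n} | agree o.+1 B (o |: X))
     (strip g ((o \in X : nat) ::
        [seq ((p \in o |: X) + (p \notin B))%N | p <- drop o.+1 (enum 'I_n)]))%:R * w B +
  \sum_(B : {set 'I_n} | agree o.+1 B (X :\ o))
     (strip g ((o \in X).+1 ::
        [seq ((p \in X :\ o) + (p \notin B))%N | p <- drop o.+1 (enum 'I_n)]))%:R * w B.
Proof.
have dropE : drop o (enum 'I_n) = o :: drop o.+1 (enum 'I_n).
  by rewrite (drop_nth o) ?size_enum_ord // nth_ord_enum.
have ne (p : 'I_n) : p \in drop o.+1 (enum 'I_n) -> p != o.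
  have := enum_uniq 'I_n; rewrite -{1}(cat_take_drop o (enum 'I_n)) dropE.
  rewrite cat_uniq => /and3P[_ _ /andP[+ _]] pin.
  by apply: contraNneq => po; rewrite po in pin.
rewrite /partial_strip (bigID (fun B : {set 'I_n} => o \in B)) /= dropE; congr (_ + _).
  apply: eq_big => [B|B /andP[_ oB]].
    rewrite agreeS setU11 eqb_id; congr (_ && _); apply: agree_eq => b bo.
    by rewrite !inE -val_eqE /= ltn_eqF.
  rewrite /= oB addn0; congr ((strip g (_ :: _))%:R * _); apply/eq_in_map => p /ne po.
  by rewrite !inE (negPf po).
apply: eq_big => [B|B /andP[_ oB]].
  rewrite agreeS !inE eqxx /= eqbF_neg; congr (_ && _); apply: agree_eq => b bo.
  by rewrite !inE -val_eqE /= ltn_eqF.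
rewrite /= oB addn1; congr ((strip g (_ :: _))%:R * _); apply/eq_in_map => p /ne po.
by rewrite !inE po.
Qed.

Lemma setD1_notin (o : 'I_n) (X : {set 'I_n}) : o \notin X -> X :\ o = X.
Proof. by move=> oX; apply/setP => x; rewrite !inE; case: eqP => // ->; rewrite (negPf oX). Qed.

Lemma setU1_in (o : 'I_n) (X : {set 'I_n}) : o \in X -> o |: X = X.
Proof. by move=> oX; apply/setUidPr; rewrite sub1set. Qed.

Lemma partial_strip1 (w : form) (o : 'I_n) (X : {set 'I_n}) :
  partial_strip w o 1 X =
  (if o \in X then 0 else partial_strip w o.+1 0 (o |: X)) + partial_strip w o.+1 1 X.
Proof.
rewrite partial_strip_rec; case: ifPn => oX /=; last by rewrite (setD1_notin oX).
rewrite (setU1_in oX) add0r [X in _ + X]big1 ?addr0 // => B _.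
by case: [seq _ | _ <- _] => [|d ds]; rewrite mul0r.
Qed.

Lemma partial_strip0 (w : form) (o : 'I_n) (X : {set 'I_n}) :
  partial_strip w o 0 X =
  (if o \in X then 2 * partial_strip w o.+1 1 (X :\ o) else 0) + partial_strip w o.+1 0 X.
Proof.
rewrite partial_strip_rec; case: ifPn => oX /=.
  rewrite (setU1_in oX) addrC; congr (_ + _); last first.
    by apply: eq_bigr => B _; rewrite mul1n.
  by rewrite mulr_sumr; apply: eq_bigr => B _; rewrite natrM mulrA.
rewrite (setD1_notin oX) big1 => [|B _]; last by rewrite mul0n mul0r.
by congr (_ + _); apply: eq_bigr => B _; rewrite mul1n.
Qed.

Lemma tail_indS (o : 'I_n) : tail_ind o = tail_ind o.+1 + [ffun x => (x == o)%:R].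
Proof.
apply/ffunP => x; rewrite !ffunE -natrD; congr _%:R.
by rewrite leq_eqVlt -val_eqE /= eq_sym; case: ltngtP.
Qed.

Lemma rampS (o : 'I_n) (f : vec) :
  ramp o f = ramp o.+1 f + (2 * ramp o.+1 f o) *: tail_ind o.+1.
Proof.
apply/ffunP => x; rewrite !ffunE (@big_pred0 _ _ _ _ _ (fun b : 'I_n => (o < b < o)%N)); last first.
  by move=> b; lia.
rewrite mulr0 addr0 /GRing.scale /= -!addrA; congr (_ + _).
case: ltnP => ox; last first.
  rewrite mulr0 addr0; congr (_ * _); apply: eq_bigl => b; lia.
rewrite (bigD1 o) /=; last by rewrite leqnn.
rewrite mulrDr addrC mulr1; congr (_ + _); congr (_ * _); apply: eq_bigl => b.
by rewrite -val_eqE /=; lia.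
Qed.

Lemma wedge_delta (o : 'I_n) (w : form) (X : {set 'I_n}) :
  wedge [ffun x => (x == o)%:R] w X = if o \in X then (-1) ^+ below o X * w (X :\ o) else 0.
Proof.
rewrite ffunE; case: ifPn => oX; last first.
  rewrite big1 // => a aX; rewrite ffunE.
  by case: eqP aX oX => [->->//|]; rewrite mulr0 mul0r.
rewrite (bigD1 o) //= big1 ?addr0 ?ffunE ?eqxx ?mulr1 // => a /andP[_ /negPf ao].
by rewrite ffunE ao mulr0 mul0r.
Qed.

Lemma belowS (o : 'I_n) (X : {set 'I_n}) : below o.+1 X = ((o \in X) + below o X)%N.
Proof.
rewrite /below; case oX: (o \in X).
  rewrite (cardsD1 o) inE oX ltnS leqnn; congr (_ + _)%N; congr #|pred_of_set _|.
  by apply/setP => x; rewrite !inE -val_eqE /= ltnS; case: (x \in X); rewrite ?andbF //= ltn_neqAle.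
congr #|pred_of_set _|; apply/setP => x; rewrite !inE ltnS leq_eqVlt.
case xX: (x \in X) => //=; case: eqP => // /val_inj xo.
by rewrite xo oX in xX.
Qed.

(** Scanning the columns from right to left, the state with one unmatched site is
    the product of the ramps, and the other state has one more factor, the
    indicator of the scanned columns; its sign moves that factor past the columns
    not yet scanned.  One more column shears every ramp by a multiple of this
    indicator, so that [wedges_shear] gives the recursion. *)
Lemma partial_strip_wedges (fs : seq vec) (m i : nat) (X : {set 'I_n}) :
  (i + m = n)%N ->
  partial_strip (wedges fs form1) i 1 X = wedges (map (ramp i) fs) form1 X /\
  partial_strip (wedges fs form1) i 0 X =
    2 * ((-1) ^+ below i X * wedge (tail_ind i) (wedges (map (ramp i) fs) form1) X).
Proof.
elim: m i X => [|m IH] i X im.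
  have iE : i = n by rewrite -im addn0.
  have agX (B : {set 'I_n}) : agree i B X = (B == X).
    apply/forallP/eqP => [h|-> b]; last by rewrite eqxx implybT.
    by apply/setP => b; have := h b; rewrite iE ltn_ord => /eqP.
  rewrite /partial_strip drop_oversize; last by rewrite size_enum_ord iE.
  rewrite !(big_pred1 X agX) /= mul1r mul0r; split.
    rewrite (_ : map (ramp i) fs = fs) //; rewrite -[RHS]map_id; apply: eq_map => f.
    apply/ffunP => x; rewrite ffunE big_pred0 ?mulr0 ?addr0 // => b.
    by have := ltn_ord b; lia.
  rewrite [in RHS]ffunE big1 ?mulr0 // => a _; rewrite ffunE iE leqNgt ltn_ord.
  by rewrite mulr0 mul0r.
have io : (i < n)%N by lia.
pose o := Ordinal io; have -> : i = o by [].
have {}IH Y := IH o.+1 Y ltac:(rewrite /=; lia).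
set w := wedges fs form1 in IH *; set u := tail_ind o.+1 in IH *.
set v := wedges (map (ramp o.+1) fs) form1 in IH *.
have uo : u o = 0 by rewrite ffunE ltnn.
have vE : wedges (map (ramp o) fs) form1 = v + 2 *: wedge u (contract o v).
  rewrite -(wedges_shear _ _ uo) -map_comp; congr (wedges _ _).
  by apply: eq_map => f; rewrite rampS.
have cw := contract_wedge o u v; rewrite uo scale0r sub0r in cw.
split.
  rewrite partial_strip1 (IH X).1 vE [in RHS]ffunE [in RHS]ffunE addrC; congr (_ + _).
  have /ffunP/(_ X) := cw; rewrite [LHS]ffunE [RHS]ffunE; case: ifPn => oX.
    by move/eqP; rewrite eq_sym oppr_eq0 => /eqP ->; rewrite scaler0.
  rewrite (IH (o |: X)).2 belowS setU11 (belowU1 o oX) ltnn add0n => h.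
  rewrite exprS mulN1r mulNr h opprK; by [].
rewrite partial_strip0 (IH X).2 (IH (X :\ o)).1 vE belowS tail_indS -/u.
rewrite wedgeDl 2!wedgeDr 2!wedgeZr wedge_sq scaler0 addr0.
have addE (a b : form) : (a + b) X = a X + b X by rewrite ffunE.
have scaleE c (a : form) : (c *: a) X = c * a X by rewrite ffunE.
rewrite !addE scaleE !wedge_delta; case: ifPn => oX; last by rewrite mulr0 !addr0 add0r.
have /ffunP/(_ (X :\ o)) := cw; rewrite [LHS]ffunE [RHS]ffunE setD11 setD1K //.
rewrite [below o X](belowD1 o oX) ltnn add0n exprS => /eqP.
rewrite eq_sym eqr_oppLR => /eqP ->.
have sg2 := sqrr_sign R (below o (X :\ o)).
set s := (-1) ^+ _ in sg2 *; set x := v _; set y := wedge u v X.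
have alg (s' x' y' : R) : s' ^+ 2 = 1 ->
    2 * x' + 2 * (-1 * s' * y') = 2 * (s' * (y' + (s' * x' + 2 * (s' * - (s' * y'))))).
  move=> s2; transitivity (2 * s' * y' + s' ^+ 2 * (2 * x') - s' ^+ 2 * (4 * s' * y')).
    by rewrite s2; ring.
  by ring.
exact: alg.
Qed.

(** One strip sums every factor and adjoins the constant function
    [tail_ind 0]. *)
Lemma strip_wedges (fs : seq vec) (A : {set 'I_n}) :
  \sum_(B : {set 'I_n}) (strip 0 (strip_counts A B))%:R * wedges fs form1 B =
  2 * wedge (tail_ind 0) (wedges (map (ramp 0) fs) form1) A.
Proof.
have [_] := @partial_strip_wedges fs n 0 A (add0n n).
rewrite /partial_strip drop0 (_ : below 0 A = 0%N) ?expr0 ?mul1r; last first.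
  by apply: eq_card0 => x; rewrite !inE ltn0 andbF.
move=> <-; apply: eq_bigl => B; apply/esym/forallP => b; exact: implyFb.
Qed.

End Exterior.

(** * Binomial forms and the count for half of the region *)

Section Binomials.
Variables (R : numFieldType) (n : nat).
Notation vec := {ffun 'I_n -> R^o}.
Notation form := {ffun {set 'I_n} -> R^o}.

(** From left to right, a multiple of the preceding factor can be dropped from
    every factor. *)
Lemma wedges_telescope (f : nat -> vec) (c d : nat -> R) (w : form) (i m : nat) :
  wedge (f i) (wedges [seq d j *: f j.+1 + c j *: f j | j <- iota i m] w) =
  (\prod_(j <- iota i m) d j) *: wedge (f i) (wedges [seq f j.+1 | j <- iota i m] w).
Proof.
elim: m i => [|m IH] i /=; first by rewrite big_nil scale1r.
rewrite wedgeDl wedgeDr !wedgeZl !wedgeZr wedge_sq scaler0 addr0 IH wedgeZr scalerA.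
by rewrite big_cons.
Qed.

Definition binom (j : nat) : vec := [ffun x : 'I_n => 'C(x, j)%:R].

Lemma sum_bin (j x : nat) : (\sum_(b < x) 'C(b, j) = 'C(x, j.+1))%N.
Proof. by elim: x => [|x IH]; rewrite ?big_ord0 // big_ord_recr /= IH binS addnC. Qed.

Lemma ramp_binom (j : nat) : ramp 0 (binom j) = 2 *: binom j.+1 + 1 *: binom j.
Proof.
apply/ffunP => x; rewrite !ffunE scale1r addrC; congr (_ + _).
rewrite -(sum_bin j x) natr_sum (big_ord_widen n (fun b => 'C(b, j)%:R : R)) ?(ltnW (ltn_ord x)) //.
by rewrite /GRing.scale /=; congr (_ * _); apply: eq_big => // b _; rewrite ffunE.
Qed.

Definition binom_form (m : nat) : form := wedges (map binom (iota 0 m)) (form1 R n).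

(** Each strip sends [C(x,j)] to [2 C(x,j+1) + C(x,j)], and the second term is a
    multiple of the preceding factor; a product of [m] factors thus gains
    [2 ^ m], and one more factor [2] comes from the strip itself. *)
Lemma half_count_binom (N m : nat) (B : {set 'I_n}) : (m <= N)%N ->
  (half_count N m B)%:R = 2 ^+ 'C(m.+1, 2) * binom_form m B :> R.
Proof.
elim: m B => [|m IH] B mN; first by rewrite half_count0 expr0 mul1r ffunE.
rewrite half_countS // natr_sum.
under eq_bigr => A _ do rewrite natrM (IH A (ltnW mN)) mulrCA.
rewrite -mulr_sumr strip_wedges -map_comp.
have -> : tail_ind R n 0 = binom 0 by apply/ffunP => x; rewrite !ffunE bin0.
rewrite (eq_map (g := fun j => 2 *: binom j.+1 + 1 *: binom j) ramp_binom).
rewrite (wedges_telescope binom (fun=> 1) (fun=> 2)) big_const_seq count_predT size_iota iter_mulr_1.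
rewrite [in LHS]ffunE /binom_form /= (iotaDl 1 0) -map_comp.
have -> : 'C(m.+2, 2) = ('C(m.+1, 2) + m.+1)%N by rewrite binS bin1.
by rewrite exprD exprS /GRing.scale /= -!mulrA.
Qed.

End Binomials.

(** * Signed Laplace expansion and the parity identity *)

Section Laplace.
Variables (R : numFieldType) (n : nat).
Notation vec := {ffun 'I_n -> R^o}.
Notation form := {ffun {set 'I_n} -> R^o}.
Notation "1f" := (form1 R n).

(** The inversions between the blocks [A] and [C], [A] being placed first. *)
Definition crossings (A C : {set 'I_n}) : nat := \sum_(a in A) below a C.

Lemma below_setID (i : nat) (A X : {set 'I_n}) : A \subset X ->
  below i X = (below i A + below i (X :\: A))%N.
Proof.
move=> AX; rewrite /below -(cardsID A); congr (_ + _)%N; congr #|pred_of_set _|;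
  apply/setP => x; rewrite !inE; last by rewrite andbA.
by case xA: (x \in A); rewrite ?andbF // ?andbT (subsetP AX).
Qed.

Lemma wedges_cat (fs hs : seq vec) (X : {set 'I_n}) :
  wedges fs (wedges hs 1f) X =
  \sum_(A : {set 'I_n} | A \subset X)
     (-1) ^+ crossings A (X :\: A) * (wedges fs 1f A * wedges hs 1f (X :\: A)).
Proof.
elim: fs X => [|f fs IH] X /=.
  rewrite (bigD1 set0) ?sub0set //= /crossings big_set0 expr0 !mul1r setD0.
  rewrite big1 ?addr0 ?ffunE ?eqxx ?mul1r // => A /andP[_ /negPf A0].
  by rewrite ffunE A0 mul0r mulr0.
under [RHS]eq_bigr do rewrite ffunE mulr_suml mulr_sumr.
rewrite (exchange_big_dep (mem X)) /=; last by move=> A w /subsetP h /h.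
rewrite ffunE; apply: eq_bigr => a aX; rewrite IH mulr_sumr.
rewrite [RHS](reindex_onto (fun A => a |: A) (fun A => A :\ a)) /=; last first.
  by move=> A /andP[_ wA]; rewrite setD1K.
have memE (A : {set 'I_n}) : (a |: A \subset X) && (a \in a |: A) && ((a |: A) :\ a == A) =
                          (A \subset X :\ a).
  rewrite subsetD1 subUset sub1set aX setU11 andbT /=; congr (_ && _).
  by apply/eqP/idP => [<-|/setU1K//]; rewrite !inE eqxx.
apply: eq_big => [A|A AX]; first by rewrite memE.
move: (AX); rewrite -memE => /andP[/andP[aAX _] /eqP aA].
have anA : a \notin A by rewrite -aA !inE eqxx.
rewrite aA setDDl (below_setID a aAX).
have -> : crossings (a |: A) (X :\: (a |: A)) =
    (below a (X :\: (a |: A)) + crossings A (X :\: (a |: A)))%N.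
  by rewrite /crossings big_setU1.
rewrite !exprD; set s := (-1) ^+ below a (a |: A); set t := (-1) ^+ _; set r := (-1) ^+ _.
have alg (s' t' r' z u v : R) : s' * t' * z * (r' * (u * v)) = t' * r' * (s' * z * u * v).
  by ring.
exact: alg.
Qed.

(** The degree of a product of one-forms is the number of its factors. *)
Lemma wedges_card (fs : seq vec) (X : {set 'I_n}) :
  #|X| != size fs -> wedges fs 1f X = 0.
Proof.
elim: fs X => [|f fs IH] X /= szX; first by rewrite ffunE -cards_eq0 (negPf szX).
rewrite ffunE big1 // => a aX; rewrite IH ?mulr0 //.
by move: szX; rewrite (cardsD1 a X) aX.
Qed.

Lemma wedges_mul (e : 'I_n -> R) (fs : seq vec) (X : {set 'I_n}) :
  wedges [seq [ffun x => e x * f x] | f : vec <- fs] 1f X =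
  (\prod_(x in X) e x) * wedges fs 1f X.
Proof.
elim: fs X => [|f fs IH] X /=.
  by rewrite !ffunE; case: eqP => [->|]; rewrite ?mulr0 // big_set0 mul1r.
rewrite !ffunE mulr_sumr; apply: eq_bigr => a aX; rewrite IH ffunE.
by rewrite (big_setD1 a aX) /=; ring.
Qed.

Lemma wedges_comm (fs : seq vec) (g : vec) (w : form) :
  wedges fs (wedge g w) = (-1) ^+ size fs *: wedge g (wedges fs w).
Proof.
elim: fs => [|f fs IH] /=; first by rewrite scale1r.
by rewrite IH wedgeZr wedgeC exprS mulN1r scaleNr scalerN.
Qed.

Lemma crossingsE (A C : {set 'I_n}) :
  crossings A C = (\sum_(a in A) \sum_(c in C) (c < a))%N.
Proof.
apply: eq_bigr => a _; rewrite /below -sum1_card big_mkcond [RHS]big_mkcond.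
by apply: eq_bigr => c _; rewrite inE; case: (c \in C) => //=; case: (c < a)%N.
Qed.

Lemma crossings_self (C : {set 'I_n}) : crossings C C = 'C(#|C|, 2).
Proof.
have : (crossings C C + crossings C C + #|C| = #|C| * #|C|)%N.
  rewrite {1 2}crossingsE {1}exchange_big /= -big_split -[in LHS]sum1_card -big_split.
  rewrite -sum_nat_const; apply: eq_bigr => a aC /=.
  rewrite -big_split /= -[RHS]sum1_card (bigD1 a) //= [RHS](bigD1 a) //= ltnn !add0n addnC.
  congr (_ + _)%N; apply: eq_bigr => c /andP[_]; rewrite -val_eqE /=.
  by case: ltngtP.
by rewrite bin2 -divn2; case: #|C| => [|k]; rewrite ?muln0 /= => h; nia.
Qed.

Lemma crossingsC (A C : {set 'I_n}) : [disjoint A & C] ->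
  (crossings A C + crossings C A = #|A| * #|C|)%N.
Proof.
move=> dis; rewrite !crossingsE [X in (_ + X)%N]exchange_big /= -big_split -sum_nat_const.
apply: eq_bigr => a aA; rewrite -big_split -sum1_card /=; apply: eq_bigr => c cC.
have : (a != c :> nat) by apply: contraTneq aA => /val_inj ->; rewrite (disjointFl dis cC).
by case: ltngtP.
Qed.

(** Factors supported in [E] followed by factors supported off [E]: the Laplace
    expansion has a single term. *)
Lemma wedges_split (E : {set 'I_n}) (fs hs : seq vec) (X : {set 'I_n}) :
  wedges [seq [ffun x => (x \in E)%:R * f x] | f : vec <- fs]
    (wedges [seq [ffun x => (x \notin E)%:R * f x] | f : vec <- hs] 1f) X =
  (-1) ^+ crossings (X :&: E) (X :\: E) *
    (wedges fs 1f (X :&: E) * wedges hs 1f (X :\: E)).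
Proof.
have prod1 (P : pred 'I_n) (A : {set 'I_n}) :
    \prod_(x in A) (P x)%:R = [forall x in A, P x]%:R :> R.
  case: (boolP [forall x in A, P x]) => [/forall_inP h|].
    by rewrite big1 // => x /h ->.
  by rewrite negb_forall => /existsP[x]; rewrite negb_imply => /andP[xA /negPf Px];
     rewrite (bigD1 x) //= Px mul0r.
have XE : X :\: (X :&: E) = X :\: E by apply/setP => x; rewrite !inE; case: (x \in X); rewrite ?andbF ?andbT.
rewrite wedges_cat (bigD1 (X :&: E)) ?subsetIl //= big1 ?addr0; last first.
  move=> A /andP[AX ne]; rewrite (wedges_mul (fun x => (x \in E)%:R)).
  rewrite (wedges_mul (fun x => (x \notin E)%:R)) !prod1.
  case: (boolP [forall x in A, x \in E]) => [/forall_inP AE|]; last by rewrite !mul0r mulr0.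
  case: (boolP [forall x in X :\: A, x \notin E]) => [/forall_inP CE|]; last by rewrite mul0r !mulr0.
  case/eqP: ne; apply/setP => x; rewrite !inE; apply/idP/andP => [xA|[xX xE]].
    by rewrite (subsetP AX) ?AE.
  by apply: contraTT xE => xA; apply: CE; rewrite !inE xA xX.
rewrite XE (wedges_mul (fun x => (x \in E)%:R)) (wedges_mul (fun x => (x \notin E)%:R)) !prod1.
have -> : [forall x in X :&: E, x \in E] by apply/forall_inP => x; rewrite inE => /andP[].
have -> : [forall x in X :\: E, x \notin E] by apply/forall_inP => x; rewrite inE => /andP[].
by rewrite !mul1r.
Qed.

(** With [p] and [q] the restrictions of [h] to [E] and to its complement,
    [h ^ (p - q) = (p + q) ^ (p - q) = -2 p ^ q]. *)
Lemma wedges_sign_pairs (E : {set 'I_n}) (hs : seq vec) (w : form) :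
  wedges hs (wedges [seq [ffun x => ((x \in E)%:R - (x \notin E)%:R) * f x] | f : vec <- hs] w) =
  (-2) ^+ size hs *:
    wedges [seq [ffun x => (x \in E)%:R * f x] | f : vec <- hs]
     (wedges [seq [ffun x => (x \notin E)%:R * f x] | f : vec <- hs] w).
Proof.
elim: hs => [|h hs IH] /=; first by rewrite scale1r.
set p := [ffun x => (x \in E)%:R * h x]; set q := [ffun x => (x \notin E)%:R * h x].
have hE : h = p + q.
  by apply/ffunP => x; rewrite !ffunE -mulrDl -natrD; case: (x \in E); rewrite mul1r.
have -> : [ffun x => ((x \in E)%:R - (x \notin E)%:R) * h x] = p + (-1) *: q.
  by apply/ffunP => x; rewrite !ffunE mulrBl scaleN1r.
rewrite !wedges_comm IH {1}hE size_map !(wedgeDl, wedgeDr, wedgeZl, wedgeZr) !wedge_sq.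
rewrite [wedge q (wedge p _)]wedgeC !scaler0 add0r addr0 !scalerA scalerN -scaleNr -scalerDl.
by congr (_ *: _); rewrite exprS; ring.
Qed.

Lemma norm_sign (k : nat) (x : R) : `|(-1) ^+ k * x| = `|x|.
Proof. by rewrite normrM normrX normrN1 expr1n mul1r. Qed.

(** The unsigned sum is, up to a global sign, the Laplace expansion of the
    product in which the second group of factors is multiplied by the sign
    [eps x = (-1) ^ (position of x in X)]: the inversions between [A] and its
    complement and the signs on the complement cancel.  Each [h] then meets its
    signed copy, and the product becomes one of factors supported on the even
    and on the odd positions. *)
Lemma sum_wedges_parity (hs : seq vec) (f : vec) (X E : {set 'I_n}) :
    (forall x, x \in X -> (x \in E) = ~~ odd (below x X)) ->
    #|X :&: E| = (size hs).+1 ->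
    #|X| = (2 * size hs).+1 ->
  `|\sum_(A : {set 'I_n} | A \subset X)
     wedges (rcons hs f) 1f A * wedges hs 1f (X :\: A)| =
  2 ^+ size hs * `|wedges (rcons hs f) 1f (X :&: E)| * `|wedges hs 1f (X :\: E)|.
Proof.
move=> EX cE cX; set l := size hs.
pose eps (x : 'I_n) : R := (x \in E)%:R - (x \notin E)%:R.
have epsE x : x \in X -> eps x = (-1) ^+ below x X.
  move=> xX; rewrite /eps EX // -signr_odd; case: (odd _); rewrite ?expr1 ?expr0 /=.
    by rewrite sub0r.
  by rewrite subr0.
(* The signs cancel up to one that only depends on [l]. *)
have step1 : `|\sum_(A : {set 'I_n} | A \subset X)
     wedges (rcons hs f) 1f A * wedges hs 1f (X :\: A)| =
  `|wedges (rcons hs f) (wedges [seq [ffun x => eps x * g x] | g : vec <- hs] 1f) X|.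
  rewrite wedges_cat -(norm_sign ((l.+1 * l) + 'C(l, 2)) (\sum_(_ | _) (_ * _))) mulr_sumr.
  congr `|_|; apply: eq_bigr => A AX; rewrite wedges_mul.
  have [cA|cA] := eqVneq #|A| l.+1; last by rewrite wedges_card ?size_rcons // !mul0r !mulr0.
  have cC : #|X :\: A| = l.
    by have := cardsID A X; rewrite (setIidPr AX) cA cX -/l; lia.
  have -> : \prod_(x in X :\: A) eps x = (-1) ^+ (crossings (X :\: A) A + 'C(l, 2)).
    rewrite -cC -crossings_self -big_split /= -prodrXr.
    apply: eq_bigr => x xC; rewrite epsE; last by move: xC; rewrite inE => /andP[].
    by rewrite (below_setID x AX).
  have dis : [disjoint A & X :\: A].
    by rewrite -setI_eq0; apply/eqP/setP => x; rewrite !inE; case: (x \in A).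
  have -> : (l.+1 * l = crossings A (X :\: A) + crossings (X :\: A) A)%N.
    by rewrite crossingsC // cA cC.
  rewrite !exprD.
  set s := (-1) ^+ _; set t := (-1) ^+ _; set r := (-1) ^+ _.
  have alg (s' t' r' u v : R) : s' * t' * r' * (u * v) = s' * (u * (t' * r' * v)) by ring.
  exact: alg.
pose resE := [seq [ffun x => (x \in E)%:R * g x] | g : vec <- hs].
pose resO := [seq [ffun x => (x \notin E)%:R * g x] | g : vec <- hs].
pose fE : vec := [ffun x => (x \in E)%:R * f x].
pose fO : vec := [ffun x => (x \notin E)%:R * f x].
have fEO : f = fE + fO.
  by apply/ffunP => x; rewrite !ffunE -mulrDl -natrD; case: (x \in E); rewrite mul1r.
have move_in g : wedge g (wedges resE (wedges resO 1f)) =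
                 (-1) ^+ l *: wedges resE (wedge g (wedges resO 1f)).
  by rewrite wedges_comm size_map scalerA -expr2 sqrr_sign scale1r.
have partE : wedges resE (wedge fE (wedges resO 1f)) X =
    (-1) ^+ crossings (X :&: E) (X :\: E) *
      (wedges (rcons hs f) 1f (X :&: E) * wedges hs 1f (X :\: E)).
  by rewrite -wedges_split map_rcons -cats1 /wedges foldr_cat.
(* One factor too few is left for the even positions. *)
have partO : wedges resE (wedge fO (wedges resO 1f)) X = 0.
  have -> : wedge fO (wedges resO 1f) =
      wedges [seq [ffun x => (x \notin E)%:R * g x] | g : vec <- f :: hs] 1f by [].
  rewrite wedges_split wedges_card ?mul0r ?mulr0 // cE; lia.
have total : `|wedge f (wedges resE (wedges resO 1f)) X| =
    `|wedges (rcons hs f) 1f (X :&: E) * wedges hs 1f (X :\: E)|.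
  rewrite {1}fEO wedgeDl !move_in -scalerDr [X in `|X|]ffunE norm_sign ffunE partE partO.
  by rewrite addr0 norm_sign.
rewrite step1 -cats1 {1}/wedges foldr_cat /= -!/(wedges _ _).
have scaleE c (a : form) : (c *: a) X = c * a X by rewrite ffunE.
rewrite wedges_comm wedges_sign_pairs wedgeZr !scaleE norm_sign normrM.
by rewrite normrX normrN normr_nat total normrM cats1 mulrA.
Qed.

End Laplace.

(** * Vandermonde evaluation *)

(** The product of the differences of a list, later entries minus earlier
    ones. *)
Fixpoint vandermonde (s : seq nat) : nat :=
  if s is x :: s' then (\prod_(y <- s') (y - x) * vandermonde s')%N else 1.

Section Vandermonde.
Variables (R : numFieldType) (n : nat).
Notation vec := {ffun 'I_n -> R^o}.
Notation "1f" := (form1 R n).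

Definition set_of_seq (s : seq nat) : {set 'I_n} := [set x : 'I_n | (x : nat) \in s].

Lemma prod_set_of_seq (s : seq nat) (F : nat -> R) :
  uniq s -> all (fun x => x < n)%N s ->
  \prod_(x in set_of_seq s) F x = \prod_(y <- s) F y.
Proof.
move=> us /allP sn; rewrite (eq_bigl (fun x : 'I_n => (x : nat) \in s)) => [|x]; last by rewrite inE.
rewrite -(big_mkord (fun i => i \in s) F) -big_filter; apply: perm_big.
apply: uniq_perm; rewrite ?filter_uniq ?iota_uniq // => x.
by rewrite mem_filter mem_index_iota; case xs: (x \in s) => //=; rewrite sn.
Qed.

Lemma card_set_of_seq (s : seq nat) :
  uniq s -> all (fun x => x < n)%N s -> #|set_of_seq s| = size s.
Proof.
move=> us /allP sn; rewrite -sum1_card (eq_bigl (fun x : 'I_n => (x : nat) \in s)) => [|x]; last by rewrite inE.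
rewrite -(big_mkord (fun i => i \in s) (fun=> 1%N)) -big_filter sum1_size; apply: perm_size.
apply: uniq_perm; rewrite ?filter_uniq ?iota_uniq // => x.
by rewrite mem_filter mem_index_iota; case xs: (x \in s) => //=; rewrite sn.
Qed.

Definition falling (j : nat) : vec := [ffun x : 'I_n => (x ^_ j)%:R].

(** Falling factorials satisfy [x^_(j+1) = (x - a) x^_j + (a - j) x^_j]. *)
Lemma falling_shift (a j : nat) :
  [ffun x : 'I_n => (x%:R - a%:R) * falling j x] =
  1 *: falling j.+1 + (j%:R - a%:R) *: falling j :> vec.
Proof.
apply/ffunP => x; rewrite !ffunE scale1r ffactnSr natrM /GRing.scale /=.
have [jx|xj] := leqP j x; first by rewrite natrB //; ring.
by rewrite ffact_small // !(mul0r, mulr0) addr0.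
Qed.

(** By [falling_shift], every factor but the constant one may be replaced by
    [x - a] times the preceding one, where [a] is the least node.  All of them
    vanish at [a], which must then be taken by the constant factor; the others
    give the product of the [y - a] and a shorter list. *)
Lemma wedges_falling (s : seq nat) :
  sorted ltn s -> all (fun x => x < n)%N s ->
  wedges (map falling (iota 0 (size s))) 1f (set_of_seq s) = (vandermonde s)%:R.
Proof.
elim: s => [|a s IH] /=.
  by move=> _ _; rewrite ffunE (_ : set_of_seq [::] = set0) ?eqxx //; apply/setP => x; rewrite !inE.
move=> srt /andP[an sn]; have srt_s := path_sorted srt.
have us : uniq s by apply: sorted_uniq srt_s => //; [exact: ltn_trans | move=> x; apply: ltnn].
have a_lt y : y \in s -> (a < y)%N.
  by move: y; apply/allP; apply: order_path_min srt; exact: ltn_trans.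
have -> : wedge (falling 0) (wedges (map falling (iota 1 (size s))) 1f) =
    wedge (falling 0)
      (wedges [seq [ffun x : 'I_n => (x%:R - a%:R) * f x] | f : vec <- map falling (iota 0 (size s))] 1f).
  rewrite (iotaDl 1 0) -!map_comp.
  rewrite (eq_map (g := fun j => 1 *: falling j.+1 + (j%:R - a%:R) *: falling j)
     (falling_shift a)).
  by rewrite (wedges_telescope falling (fun j => j%:R - a%:R) (fun=> 1)) big1_eq scale1r //.
pose oa := Ordinal an.
have setE : set_of_seq (a :: s) :\ oa = set_of_seq s.
  apply/setP => x; rewrite !inE -val_eqE /=; case: eqP => //= -> .
  by apply/esym/negP => /a_lt; rewrite ltnn.
have oaX : oa \in set_of_seq (a :: s) by rewrite !inE eqxx.
rewrite ffunE (bigD1 oa) //= big1 ?addr0; last first.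
  move=> b /andP[bX boa]; rewrite (wedges_mul (fun x : 'I_n => x%:R - a%:R)).
  by rewrite (bigD1 oa) /= ?subrr ?mul0r ?mulr0 // !inE eq_sym boa eqxx.
have -> : below oa (set_of_seq (a :: s)) = 0%N.
  apply: eq_card0 => x; rewrite !inE; apply/negP => /andP[/orP[/eqP->|/a_lt]]; rewrite ?ltnn //=.
  by case: ltngtP.
rewrite expr0 ffunE ffactn0 !mul1r setE (wedges_mul (fun x : 'I_n => x%:R - a%:R)) IH //.
rewrite (prod_set_of_seq (fun x => x%:R - a%:R)) // natrM natr_prod; congr (_ * _).
by apply: eq_big_seq => y /a_lt ay; rewrite natrB // ltnW.
Qed.

Lemma wedges_scale (c : nat -> R) (f : nat -> vec) (r : seq nat) (w : {ffun {set 'I_n} -> R^o}) :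
  wedges [seq c j *: f j | j <- r] w = (\prod_(j <- r) c j) *: wedges (map f r) w.
Proof.
elim: r => [|j r IH] /=; first by rewrite big_nil scale1r.
by rewrite IH wedgeZl wedgeZr scalerA big_cons.
Qed.

Lemma binom_form_vandermonde (s : seq nat) :
  sorted ltn s -> all (fun x => x < n)%N s ->
  (\prod_(0 <= j < size s) j`!)%:R * binom_form R n (size s) (set_of_seq s) =
  (vandermonde s)%:R.
Proof.
move=> srt sn; rewrite -(wedges_falling srt sn) natr_prod /binom_form.
have -> : map falling (iota 0 (size s)) =
    [seq (j`!)%:R *: binom R n j | j <- iota 0 (size s)].
  apply: eq_map => j; apply/ffunP => x; rewrite !ffunE -bin_ffact natrM mulrC.
  by [].
have scaleE c (w : {ffun {set 'I_n} -> R^o}) X : (c *: w) X = c * w X by rewrite ffunE.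
by rewrite wedges_scale scaleE /index_iota subn0.
Qed.

End Vandermonde.

(** * Products over arithmetic progressions *)

Lemma vandermonde_cat (s t : seq nat) :
  vandermonde (s ++ t) =
  (vandermonde s * vandermonde t * \prod_(x <- s) \prod_(y <- t) (y - x))%N.
Proof.
elim: s => [|x s IH] /=; first by rewrite big_nil mul1n muln1.
by rewrite IH big_cons big_cat /=; ring.
Qed.

Definition arith (c m : nat) : seq nat := [seq (c + 2 * i)%N | i <- iota 0 m].

Lemma vandermonde_arith (c m : nat) :
  vandermonde (arith c m) = (\prod_(1 <= d < m) (2 * d) ^ (m - d))%N.
Proof.
elim: m c => [|m IH] c; first by rewrite big_geq.
have -> : arith c m.+1 = c :: arith (c + 2) m.
  rewrite /arith /= muln0 addn0 (iotaDl 1 0) -map_comp; congr cons.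
  by apply: eq_map => i /=; lia.
rewrite /= IH {1}/arith big_map.
have -> : (\prod_(j <- iota 0 m) (c + 2 + 2 * j - c) = \prod_(1 <= d < m.+1) (2 * d))%N.
  by rewrite big_add1 /= /index_iota subn0; apply: eq_bigr => j _; lia.
case: m {IH} => [|m]; first by rewrite !big_geq.
rewrite [X in (_ * X)%N](_ : _ = \prod_(1 <= d < m.+2) (2 * d) ^ (m.+1 - d))%N; last first.
  by rewrite [RHS]big_nat_recr //= subnn expn0 muln1.
rewrite -big_split /=; apply: eq_big_nat => d /andP[_ dm].
by rewrite -expnS; congr (_ ^ _)%N; lia.
Qed.

(** Reversing the first progression turns the difference into a function of the
    sum of the indices. *)
Lemma cross_arith (c p r : nat) :
  (\prod_(x <- arith c p) \prod_(y <- arith (c + 2 * p + 1) r) (y - x) =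
   \prod_(0 <= i < p) \prod_(0 <= j < r) (3 + 2 * (i + j)))%N.
Proof.
rewrite big_map [RHS]big_nat_rev /= /index_iota subn0 big_seq [RHS]big_seq.
apply: eq_bigr => i; rewrite mem_iota => ip.
by rewrite big_map subn0; apply: eq_bigr => j _; lia.
Qed.

(** In the rectangle [p] by [r], the antidiagonal of sum [s] has the number of
    cells given by the exponent. *)
Lemma prod_antidiagonals (F : nat -> nat) (p r M : nat) : (p + r <= M.+1)%N ->
  (\prod_(0 <= i < p) \prod_(0 <= j < r) F (i + j) =
   \prod_(0 <= s < M) F s ^ (minn s.+1 p - (s.+1 - r)))%N.
Proof.
elim: p => [|p IH] pM.
  by rewrite big_geq // big1 // => s _; rewrite minn0 sub0n.
rewrite big_nat_recr //= IH; last by lia.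
have -> : (\prod_(0 <= j < r) F (p + j) =
           \prod_(0 <= s < M) F s ^ ((p <= s) && (s < p + r)))%N.
  rewrite [RHS](big_cat_nat (n := p)) //=; last by lia.
  rewrite (big_cat_nat (n := (p + r)%N) (m := p)) /=; [|lia|lia].
  rewrite [X in (X * _)%N]big1_seq ?mul1n; last first.
    by move=> s; rewrite mem_index_iota => sI; rewrite (_ : (p <= s)%N = false) //; lia.
  rewrite [X in (_ * X)%N]big1_seq ?muln1; last first.
    by move=> s; rewrite mem_index_iota => sI; rewrite (_ : (s < p + r)%N = false) ?andbF //; lia.
  rewrite -{2}[p]add0n big_addn addKn; apply: eq_big_nat => s /andP[_ sr].
  by rewrite leq_addl [(s + p)%N]addnC ltn_add2l sr expn1.
rewrite -big_split /=; apply: eq_big_nat => s sM.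
by rewrite -expnD; congr (_ ^ _)%N; lia.
Qed.

Lemma arith_lt (c m b : nat) : (c + 2 * m <= b.+1)%N -> all (fun x => x < b)%N (arith c m).
Proof. by move=> h; apply/allP => _ /mapP[i + ->]; rewrite mem_iota; lia. Qed.

Lemma mem_arith (c m x : nat) :
  (x \in arith c m) = [&& c <= x, odd x == odd c & x < c + 2 * m]%N.
Proof.
apply/mapP/and3P => [[i + ->]|[cx /eqP ox xm]].
  by rewrite mem_iota => im; split; [lia | rewrite oddD oddM /= addbF | lia].
exists (x - c)./2; last by have := odd_double_half (x - c); rewrite oddB // ox addbb; lia.
by rewrite mem_iota; have := odd_double_half (x - c); lia.
Qed.

Lemma sorted_arith2 (c p d r : nat) : (c + 2 * p <= d.+1)%N ->
  sorted ltn (arith c p ++ arith d r).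
Proof.
have srt a m : sorted ltn (arith a m).
  by rewrite sorted_map; apply: sub_sorted (iota_ltn_sorted 0 m) => i j /=; lia.
move=> h; rewrite (sorted_pairwise ltn_trans) pairwise_cat -!(sorted_pairwise ltn_trans) !srt !andbT.
by apply/allrelP => x y; rewrite !mem_arith; lia.
Qed.

(** * The region in diagonal coordinates *)

(** The symmetry of the region that maps the square [(1, 0)] to [s]: the identity,
    the half turn, or the reflection in one of the diagonals of the central
    square. *)
Definition place (s c : cell) : cell :=
  (s.1 * c.1 + s.2 * c.2, s.2 * c.1 + s.1 * c.2).

Lemma central_nbr (s : cell) : edge_adjacent central_cell s ->
  [\/ s = (1, 0), s = (-1, 0), s = (0, 1) | s = (0, -1)].
Proof.
case: s => x y; rewrite /edge_adjacent /central_cell /= => h.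
have : (x == 1) && (y == 0) || (x == -1) && (y == 0) || (x == 0) && (y == 1) || (x == 0) && (y == -1).
  by lia.
by move=> /orP[/orP[/orP[]|]|] /andP[/eqP-> /eqP->];
  [apply: Or41|apply: Or42|apply: Or43|apply: Or44].
Qed.

Section Place.
Variables (s : cell) (hs : edge_adjacent central_cell s).

Lemma placeK : involutive (place s).
Proof. by move=> [x y]; case: (central_nbr hs) => ->; rewrite /place /=; congr pair; ring. Qed.

Lemma place_inj : injective (place s).
Proof. exact: inv_inj placeK. Qed.

Lemma place10 : place s (1, 0) = s.
Proof. by case: s => x y; rewrite /place /=; congr pair; ring. Qed.

Lemma place_adjacent c c' : edge_adjacent (place s c) (place s c') = edge_adjacent c c'.
Proof.
case: c c' => [x y] [x' y']; rewrite /edge_adjacent /place /=.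
by case: (central_nbr hs) => -> /=; lia.
Qed.

Lemma place_mem (l : nat) (c : cell) :
  (place s c \in aztec_rectangle (2 * l + 1) (2 * l + 2)) =
  (c \in aztec_rectangle (2 * l + 1) (2 * l + 2)).
Proof.
case: c => [x y]; rewrite !mem_aztec_rectangle /place /=.
by case: (central_nbr hs) => -> /=; lia.
Qed.

End Place.

Section Region.
Variable (l : nat).
Notation n := (2 * l).+2.
Notation N := (2 * l).+1.
Notation site := ('I_N.+1 * 'I_n)%type.

(** The squares [(i, j)] with [i + j] odd are the sites; row [r] is the diagonal
    [i + j = 2 r - 2 l - 1] and column [p] the diagonal
    [j - i = 2 p - 2 l - 1].  The square [(1, 0)] is in row [l + 1] and column
    [l], where [k = l + 1]. *)
Definition site_cell (w : site) : cell :=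
  ((row_of w)%:Z - (col_of w)%:Z, (row_of w)%:Z + (col_of w)%:Z - (2 * l + 1)%N%:Z).

Definition square_cell (i : nat * nat) : cell :=
  (i.1%:Z - i.2%:Z + 1, i.1%:Z + i.2%:Z - (2 * l + 1)%N%:Z).

(** The strips below row [l + 1] upwards, then those above it downwards. *)
Definition square_rows : seq nat := iota 0 l.+1 ++ [seq (N.-1 - r)%N | r <- iota 0 l].

Lemma mem_square_rows r : (r \in square_rows) = (r < N)%N.
Proof.
rewrite mem_cat mem_iota; apply/orP/idP => [[|/mapP[r' + ->]]|rN]; rewrite ?mem_iota; try lia.
have [rl|lr] := leqP r l; [by left; lia | right].
by apply/mapP; exists (N.-1 - r)%N; rewrite ?mem_iota; lia.
Qed.

Lemma uniq_square_rows : uniq square_rows.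
Proof.
rewrite cat_uniq iota_uniq andTb map_inj_in_uniq ?iota_uniq ?andbT; last first.
  by move=> r r'; rewrite !mem_iota; lia.
by apply/hasPn => _ /mapP[r + ->]; rewrite !mem_iota; lia.
Qed.

Lemma edge_adjacent_square i w :
  edge_adjacent (square_cell i) (site_cell w) = nbr i w :> nat.
Proof.
case: i => r p; rewrite /edge_adjacent /nbr /square_nbr /square_cell /site_cell /=.
by congr nat_of_bool; move: (row_of w) (col_of w) => r' p'; lia.
Qed.

Lemma mem_square_cell i :
  (square_cell i \in aztec_rectangle (2 * l + 1) (2 * l + 2)) = (i.1 < N)%N && (i.2 < n.+1)%N.
Proof. by rewrite mem_aztec_rectangle /=; lia. Qed.

Lemma mem_site_cell w : site_cell w \in aztec_rectangle (2 * l + 1) (2 * l + 2).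
Proof. by rewrite mem_aztec_rectangle /=; have := row_lt w; have := col_lt w; lia. Qed.

Lemma aztec_cells c : c \in aztec_rectangle (2 * l + 1) (2 * l + 2) ->
  (exists2 i, (i.1 < N)%N && (i.2 < n.+1)%N & c = square_cell i) \/ (exists w, c = site_cell w).
Proof.
case: c => x y; rewrite mem_aztec_rectangle /= => h.
pose a := absz ((x : int) + y + 2 * l%:Z + 1); pose b := absz ((y : int) - x + 2 * l%:Z + 2).
have [odd_a|even_a] := boolP (odd a).
  left; exists (a./2, b./2); rewrite /= /square_cell /=; first by rewrite /a /b; lia.
  by congr pair; rewrite /a /b in odd_a *; lia.
have rN : (a./2 < N.+1)%N by rewrite /a; lia.
have pn : (b./2 < n)%N by rewrite /a /b in even_a *; lia.
right; exists (Ordinal rN, Ordinal pn); rewrite /site_cell /row_of /col_of /=.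
by congr pair; rewrite /a /b in even_a *; lia.
Qed.

(** With the symmetry that moves the removed square to [(1, 0)], the region is cut
    along the row of that square. *)
Lemma region_tilings (s : cell) (t : 'I_n) :
    edge_adjacent central_cell s -> t = l :> nat ->
  num_domino_tilings (aztec_rectangle (2 * l + 1) (2 * l + 2) `\ s)%fset =
  (\sum_(B : {set 'I_n} | B \subset [set~ t])
     half_count N l.+1 B * half_count N l ([set~ t] :\: B))%N.
Proof.
move=> hs tl; rewrite -(perm_sum_cut [set~ t] (_ : l.+1 + l = N)%N); last by lia.
set A := (_ `\ s)%fset; set X := [set w : site | _].
have memA c : (place s c \in A) = (c != (1, 0)) && (c \in aztec_rectangle (2 * l + 1) (2 * l + 2)).
  by rewrite in_fsetD1 place_mem // -[X in _ != X](place10 s) (inj_eq (place_inj hs)).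
have siteX w : (w \in X) = (site_cell w != (1, 0)).
  rewrite inE in_setC1 -val_eqE /= tl -[nat_of_ord w.2]/(col_of w) xpair_eqE.
  by move: (row_of w) (col_of w) => r p; lia.
rewrite -(eq_perm_sum X (F := fun i w => edge_adjacent (place s (square_cell i)) (place s (site_cell w)) : nat)); last first.
  by move=> i _ w; rewrite place_adjacent // edge_adjacent_square.
rewrite -/square_rows.
rewrite -(@card_tilings_perm A site _ (place s \o site_cell) (place s \o square_cell)
  (squares n square_rows) X setT) //.
- apply: inj_comp (place_inj hs) _ => -[a b] [a' b'] [] /=; rewrite /row_of /col_of /= => e1 e2.
  by congr pair; apply: val_inj => /=; lia.
- by apply: inj_comp (place_inj hs) _ => -[a b] [a' b'] [] /= e1 e2; congr pair; lia.
- apply: allpairs_uniq; rewrite ?uniq_square_rows ?iota_uniq //.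
  by move=> [? ?] [? ?].
- by move=> w w' /=; rewrite place_adjacent // /edge_adjacent /=; lia.
- by move=> i i' /=; rewrite place_adjacent // /edge_adjacent /=; lia.
- by move=> i w /=; rewrite (inj_eq (place_inj hs)) xpair_eqE; lia.
- move=> _ /mapP[_ /allpairsP[[r p] [rr pp ->]] ->].
  move: rr pp; rewrite mem_square_rows mem_iota /comp memA mem_square_cell.
  by rewrite xpair_eqE /=; lia.
- by move=> w; rewrite siteX /= memA mem_site_cell andbT.
move=> v; rewrite inE; apply/esym.
have := valP v; rewrite -[val v](placeK hs) memA => /andP[ne /aztec_cells[[i iN e]|[w e]]].
  apply/orP; left; apply/mapP; exists i; last by rewrite /= -e.
  case: i iN {e} => r p /andP[rN pn]; apply/allpairsP; exists (r, p).
  by split; rewrite ?mem_square_rows ?mem_iota.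
apply/orP; right; apply/existsP; exists w.
by rewrite siteX -e ne /= e eqxx.
Qed.

End Region.

(** * The number of tilings *)

(** The lists [s1] and [s2] are the even and the odd positions of the remaining
    sites of the row, counted from [0]; the position of [x] is [x] or [x - 1],
    according to its side of the removed site [l]. *)
Lemma region_count (l : nat) (s : cell) (s1 s2 : seq nat) :
    edge_adjacent central_cell s ->
    sorted ltn s1 -> sorted ltn s2 ->
    all (fun x => x < (2 * l).+2)%N s1 -> all (fun x => x < (2 * l).+2)%N s2 ->
    size s1 = l.+1 -> size s2 = l ->
    (forall x, (x < (2 * l).+2)%N -> (x \in s1) = (x != l) && ~~ odd (x - (l < x))) ->
    (forall x, (x < (2 * l).+2)%N -> (x \in s2) = (x != l) && odd (x - (l < x))) ->
  (num_domino_tilings (aztec_rectangle (2 * l + 1) (2 * l + 2) `\ s)%fset *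
     ((\prod_(0 <= j < l.+1) j`!) * (\prod_(0 <= j < l) j`!)) =
   2 ^ (l.+1 ^ 2 + l) * (vandermonde s1 * vandermonde s2))%N.
Proof.
move=> hs srt1 srt2 lt1 lt2 sz1 sz2 mem1 mem2.
have ln : (l < (2 * l).+2)%N by lia.
pose t : 'I_(2 * l).+2 := Ordinal ln; pose X := [set~ t].
pose E := set_of_seq (2 * l).+2 s1; pose O := set_of_seq (2 * l).+2 s2.
have memX x : (x \in X) = (x != l :> nat) by rewrite in_setC1 -val_eqE.
have XE : X :&: E = E.
  apply/setP => x; rewrite in_setI memX inE mem1 //.
  by case: eqP.
have XO : X :\: E = O.
  apply/setP => x; rewrite in_setD memX !inE mem1 // mem2 //.
  by case: eqP => //= _; rewrite negbK andbT.
have us1 : uniq s1 by apply: sorted_uniq srt1; [exact: ltn_trans | exact: ltnn].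
have us2 : uniq s2 by apply: sorted_uniq srt2; [exact: ltn_trans | exact: ltnn].
have cE : #|E| = l.+1 by rewrite card_set_of_seq.
have cX : #|X| = (2 * l).+1 by rewrite cardsC1 card_ord.
have below_all (x : 'I_(2 * l).+2) : below x [set: 'I_(2 * l).+2] = x.
  rewrite /below -sum1_card (eq_bigl (fun y : 'I_(2 * l).+2 => (y < x)%N)) => [|y]; last by rewrite !inE.
  by rewrite -(big_ord_widen _ (fun=> 1%N) (ltnW (ltn_ord x))) sum1_card card_ord.
have below_X (x : 'I_(2 * l).+2) : below x X = (x - (l < x))%N.
  by have := belowD1 x (in_setT t); rewrite below_all setTD -/X /=; lia.
have parity x : x \in X -> (x \in E) = ~~ odd (below x X).
  by move=> xX; rewrite inE mem1 // below_X -memX xX.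
pose hsq := map (binom rat (2 * l).+2) (iota 0 l).
have szh : size hsq = l by rewrite size_map size_iota.
have bform : binom_form rat (2 * l).+2 l.+1 =
    wedges (rcons hsq (binom rat _ l)) (form1 rat _).
  by rewrite /binom_form -[in iota 0 l.+1]addn1 iotaD map_cat cats1.
have := @sum_wedges_parity rat _ hsq (binom rat _ l) X E parity.
rewrite szh XE XO -bform => /(_ cE cX) key.
have count : (num_domino_tilings (aztec_rectangle (2 * l + 1) (2 * l + 2) `\ s)%fset)%:R =
    2 ^+ (l.+1 ^ 2) * \sum_(B : {set 'I_(2 * l).+2} | B \subset X)
      binom_form rat _ l.+1 B * binom_form rat _ l (X :\: B) :> rat.
  rewrite (region_tilings (t := t)) // natr_sum mulr_sumr; apply: eq_bigr => B _.
  rewrite natrM !half_count_binom; try lia.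
  have -> : (l.+1 ^ 2 = 'C(l.+2, 2) + 'C(l.+1, 2))%N.
    have h : ('C(l.+1, 2) * 2 = l.+1 * l)%N by rewrite (bin_ffact l.+1 2) ffactnS ffactn1.
    by rewrite [in 'C(l.+2, 2)]binS bin1; nia.
  by rewrite exprD; ring.
have v1 := binom_form_vandermonde rat srt1 lt1; rewrite sz1 -/E in v1.
have v2 := binom_form_vandermonde rat srt2 lt2; rewrite sz2 -/O in v2.
apply/eqP; rewrite -(eqr_nat rat) natrM -[X in X * _]normr_nat count normrM key.
rewrite normrX normr_nat -[wedges hsq _]/(binom_form rat _ l).
have {}v1 := congr1 Num.norm v1; rewrite normrM !normr_nat in v1.
have {}v2 := congr1 Num.norm v2; rewrite normrM !normr_nat in v2.
by rewrite !natrM natrX -v1 -v2 exprD; apply/eqP; ring.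
Qed.

Lemma natr_ratio (R : numFieldType) (t a b v w : nat) (P : R) :
    (t * (a * b) = v)%N -> v%:R = w%:R * P -> (0 < a)%N -> (0 < b)%N ->
  t%:R = w%:R / (b%:R * a%:R) * P.
Proof.
move=> e vP a0 b0; have ne : b%:R * a%:R != 0 :> R by rewrite -natrM pnatr_eq0; lia.
apply: (mulIf ne); rewrite [RHS]mulrAC divfK // -vP -e !natrM; ring.
Qed.

Lemma prod_fact_gt0 m : (0 < \prod_(0 <= j < m) j`!)%N.
Proof. by rewrite prodn_gt0 // => j; apply: fact_gt0. Qed.

Lemma superfactorialE (m : nat) : superfactorial (m%:Z - 1) = (\prod_(0 <= j < m) j`!)%N.
Proof.
case: m => [|m]; first by rewrite big_geq.
have -> : m.+1%:Z - 1 = m by lia.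
by rewrite /= [RHS]big_nat_recl // fact0 mul1n big_add1.
Qed.

Lemma prod_extend_last (m : nat) :
  (\prod_(1 <= d < m) (2 * d) ^ (m - d) = \prod_(1 <= d < m.+1) (2 * d) ^ (m - d))%N.
Proof.
case: m => [|m]; first by rewrite !big_geq.
by rewrite [RHS]big_nat_recr //= subnn expn0 muln1.
Qed.

(** The even differences occur within the progressions, the odd ones between
    them. *)
Lemma even_products (p : nat) (q := p.+1) :
  (vandermonde (arith 0 q ++ arith (2 * q + 1) q) *
   vandermonde (arith 1 p ++ arith (2 * q) q) =
   \prod_(1 <= d < q) (2 * d) ^ (4 * q - 4 * d - 1) *
   \prod_(1 <= d < q) (2 * d + 1) ^ (2 * d) *
   \prod_(0 <= d < q) (2 * q + 1 + 2 * d) ^ (2 * q - 1 - 2 * d))%N.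
Proof.
have c1 := cross_arith 0 q q; have c2 := cross_arith 1 p q.
rewrite (_ : 0 + 2 * q + 1 = 2 * q + 1)%N in c1; last by lia.
rewrite (_ : 1 + 2 * p + 1 = 2 * q)%N in c2; last by rewrite /q; lia.
rewrite !vandermonde_cat !vandermonde_arith c1 c2.
rewrite !(@prod_antidiagonals (fun s => 3 + 2 * s)%N _ _ (2 * p).+1); try by rewrite /q; lia.
rewrite -/q.
rewrite (prod_extend_last p) -/q.
transitivity (\prod_(1 <= d < q) ((2 * d) ^ (q - d) * (2 * d) ^ (q - d) * ((2 * d) ^ (p - d) * (2 * d) ^ (q - d))) *
  \prod_(0 <= s < (2 * p).+1) ((3 + 2 * s) ^ (minn s.+1 q - (s.+1 - q)) * (3 + 2 * s) ^ (minn s.+1 p - (s.+1 - q))))%N.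
  by rewrite !big_split /=; ring.
rewrite -mulnA; congr (_ * _)%N.
  apply: eq_big_nat => d dq; rewrite -!expnD; congr (_ ^ _)%N; rewrite /q in dq *; lia.
rewrite (big_cat_nat (n := p)) //=; last by lia.
congr (_ * _)%N.
  rewrite [RHS]big_add1 /=; apply: eq_big_nat => d dp; rewrite -!expnD.
  by congr (_ ^ _)%N; rewrite /q; lia.
rewrite -{1}[p]add0n big_addn (_ : ((2 * p).+1 - p = q)%N); last by rewrite /q; lia.
apply: eq_big_nat => d dq; rewrite -!expnD.
by congr (_ ^ _)%N; rewrite /q in dq *; lia.
Qed.

Lemma odd_products (q : nat) :
  (vandermonde (arith 0 q ++ arith (2 * q + 1) q.+1) *
   vandermonde (arith 1 q ++ arith (2 * q + 2) q) =
   \prod_(1 <= d < q.+1) (2 * d) ^ (4 * q - 4 * d + 1) *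
   \prod_(1 <= d < q) (2 * d + 1) ^ (2 * d) * (2 * q + 1) ^ (2 * q) *
   \prod_(1 <= d < q.+1) (2 * q + 1 + 2 * d) ^ (2 * q + 1 - 2 * d))%N.
Proof.
have c1 := cross_arith 0 q q.+1; have c2 := cross_arith 1 q q.
rewrite (_ : 0 + 2 * q + 1 = 2 * q + 1)%N in c1; last by lia.
rewrite (_ : 1 + 2 * q + 1 = 2 * q + 2)%N in c2; last by lia.
rewrite !vandermonde_cat !vandermonde_arith c1 c2.
rewrite !(@prod_antidiagonals (fun s => 3 + 2 * s)%N _ _ (2 * q)); try by lia.
case: q {c1 c2} => [|p]; first by rewrite !big_geq.
rewrite !(prod_extend_last p.+1); set q := p.+1.
transitivity (\prod_(1 <= d < q.+1) ((2 * d) ^ (q - d) * (2 * d) ^ (q.+1 - d) * ((2 * d) ^ (q - d) * (2 * d) ^ (q - d))) *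
  \prod_(0 <= s < 2 * q) ((3 + 2 * s) ^ (minn s.+1 q - (s.+1 - q.+1)) * (3 + 2 * s) ^ (minn s.+1 q - (s.+1 - q))))%N.
  by rewrite !big_split /=; ring.
rewrite -!mulnA; congr (_ * _)%N.
  apply: eq_big_nat => d dq; rewrite -!expnD; congr (_ ^ _)%N; lia.
rewrite (big_cat_nat (n := p)) /=; [|lia|rewrite /q; lia].
congr (_ * _)%N.
  rewrite [RHS]big_add1 /=; apply: eq_big_nat => d dp; rewrite -!expnD.
  by congr (_ ^ _)%N; rewrite /q; lia.
rewrite big_ltn; last by rewrite /q; lia.
congr (_ * _)%N; first by rewrite -expnD; congr (_ ^ _)%N; rewrite /q; lia.
rewrite -[p.+1]/(1 + p)%N big_addn (_ : (2 * q - p = q.+1)%N); last by rewrite /q; lia.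
apply: eq_big_nat => d dq; rewrite -!expnD.
rewrite (_ : 3 + 2 * (d + p) = 2 * q + 1 + 2 * d)%N; last by rewrite /q; lia.
by congr (_ ^ _)%N; rewrite /q in dq *; lia.
Qed.

(** For [k = 2 q], the removed site is [l = 2 q - 1]. *)
Lemma even_region_count (p : nat) (s : cell) (q := p.+1) (l := (2 * p).+1) :
  edge_adjacent central_cell s ->
  (num_domino_tilings (aztec_rectangle (2 * l + 1) (2 * l + 2) `\ s)%fset *
     ((\prod_(0 <= j < l.+1) j`!) * (\prod_(0 <= j < l) j`!)) =
   2 ^ (l.+1 ^ 2 + l) *
     (vandermonde (arith 0 q ++ arith (2 * q + 1) q) *
      vandermonde (arith 1 p ++ arith (2 * q) q)))%N.
Proof.
move=> hs; apply: region_count => //.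
- by apply: sorted_arith2; lia.
- by apply: sorted_arith2; rewrite /q; lia.
- by rewrite all_cat !arith_lt /q /l //; lia.
- by rewrite all_cat !arith_lt /q /l //; lia.
- by rewrite size_cat !size_map !size_iota /q /l; lia.
- by rewrite size_cat !size_map !size_iota /q /l; lia.
- move=> x xl; rewrite mem_cat !mem_arith.
  by case: (ltngtP x l) => xl'; rewrite /q /l in xl xl' *; lia.
move=> x xl; rewrite mem_cat !mem_arith.
by case: (ltngtP x l) => xl'; rewrite /q /l in xl xl' *; lia.
Qed.

(** For [k = 2 q + 1], the removed site is [l = 2 q]. *)
Lemma odd_region_count (q : nat) (s : cell) (l := (2 * q)%N) :
  edge_adjacent central_cell s ->
  (num_domino_tilings (aztec_rectangle (2 * l + 1) (2 * l + 2) `\ s)%fset *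
     ((\prod_(0 <= j < l.+1) j`!) * (\prod_(0 <= j < l) j`!)) =
   2 ^ (l.+1 ^ 2 + l) *
     (vandermonde (arith 0 q ++ arith (2 * q + 1) q.+1) *
      vandermonde (arith 1 q ++ arith (2 * q + 2) q)))%N.
Proof.
move=> hs; apply: region_count => //.
- by apply: sorted_arith2; lia.
- by apply: sorted_arith2; lia.
- by rewrite all_cat !arith_lt /l //; lia.
- by rewrite all_cat !arith_lt /l //; lia.
- by rewrite size_cat !size_map !size_iota /l; lia.
- by rewrite size_cat !size_map !size_iota /l; lia.
- move=> x xl; rewrite mem_cat !mem_arith.
  by case: (ltngtP x l) => xl'; rewrite /l in xl xl' *; lia.
move=> x xl; rewrite mem_cat !mem_arith.
by case: (ltngtP x l) => xl'; rewrite /l in xl xl' *; lia.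
Qed.

Theorem mainTheorem3 (k : nat) (hk : (1 <= k)%N)
    (s : cell) (hs : edge_adjacent central_cell s) :
  let region : {fset cell} :=
    (aztec_rectangle (2 * k - 1)%N (2 * k)%N `\ s)%fset in
  (forall q : nat, (1 <= q)%N -> k = (2 * q)%N ->
     (num_domino_tilings region)%:R =
     2 ^+ ((2 * q) ^ 2 + 2 * q - 1)%N
       / ((superfactorial (2 * q%:Z - 2))%:R
          * (superfactorial (2 * q%:Z - 1))%:R)
     * \prod_(1 <= d < q) (2 * d%:R) ^+ (4 * q - 4 * d - 1)%N
     * \prod_(1 <= d < q) (2 * d%:R + 1) ^+ (2 * d)%N
     * \prod_(0 <= d < q) (2 * q%:R + 1 + 2 * d%:R) ^+ (2 * q - 1 - 2 * d)%N
     :> rat)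
  /\
  (forall q : nat, k = (2 * q + 1)%N ->
     (num_domino_tilings region)%:R =
     2 ^+ ((2 * q + 1) ^ 2 + (2 * q + 1) - 1)%N
       / ((superfactorial (2 * q%:Z - 1))%:R * (superfactorial (2 * q%:Z))%:R)
     * \prod_(1 <= d < q.+1) (2 * d%:R) ^+ (4 * q - 4 * d + 1)%N
     * \prod_(1 <= d < q) (2 * d%:R + 1) ^+ (2 * d)%N
     * (2 * q%:R + 1) ^+ (2 * q)%N
     * \prod_(1 <= d < q.+1)
         (2 * q%:R + 1 + 2 * d%:R) ^+ (2 * q + 1 - 2 * d)%N
     :> rat).
Proof.
have natX (m e : nat) : m%:R ^+ e = (m ^ e)%:R :> rat by rewrite natrX.
have evenE d e : (2 * d%:R) ^+ e = ((2 * d) ^ e)%N%:R :> rat by rewrite natrX natrM.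
have oddE d e : (2 * d%:R + 1) ^+ e = ((2 * d + 1) ^ e)%N%:R :> rat.
  by rewrite natrX natrD natrM.
have lateE q d e : (2 * q%:R + 1 + 2 * d%:R) ^+ e = ((2 * q + 1 + 2 * d) ^ e)%N%:R :> rat.
  by rewrite natrX 2!natrD !natrM.
have prodE (a b : nat) (F : nat -> rat) (G : nat -> nat) :
    (forall d, F d = (G d)%:R) -> \prod_(a <= d < b) F d = (\prod_(a <= d < b) G d)%N%:R.
  by move=> FG; rewrite natr_prod; apply: eq_bigr.
split=> q.
  case: q => // p _ ->{k hk}; set q := p.+1; pose l := (2 * p).+1.
  have -> : (2 * (2 * q) - 1 = 2 * l + 1)%N by rewrite /l /q; lia.
  have -> : (2 * (2 * q) = 2 * l + 2)%N by rewrite /l /q; lia.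
  have -> : 2 * q%:Z - 2 = l%:Z - 1 by rewrite /l /q; lia.
  have -> : 2 * q%:Z - 1 = l.+1%:Z - 1 by rewrite /l /q; lia.
  rewrite !superfactorialE (natX 2%N).
  rewrite (prodE _ _ _ (fun d => (2 * d) ^ (4 * q - 4 * d - 1))%N) //.
  rewrite (prodE _ _ _ (fun d => (2 * d + 1) ^ (2 * d))%N) //.
  rewrite (prodE _ _ _ (fun d => (2 * q + 1 + 2 * d) ^ (2 * q - 1 - 2 * d))%N) //.
  have -> : ((2 * q) ^ 2 + 2 * q - 1 = l.+1 ^ 2 + l)%N by rewrite (_ : 2 * q = l.+1)%N /l /q; lia.
  rewrite -2!(mulrA (_ / _)).
  apply: natr_ratio (even_region_count p hs) _ _ _; rewrite ?prod_fact_gt0 //.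
  by rewrite even_products !natrM !mulrA.
move=> ->{k hk}; pose l := (2 * q)%N.
have -> : (2 * (2 * q + 1) - 1 = 2 * l + 1)%N by rewrite /l; lia.
have -> : (2 * (2 * q + 1) = 2 * l + 2)%N by rewrite /l; lia.
have -> : 2 * q%:Z - 1 = l%:Z - 1 by rewrite /l; lia.
have -> : 2 * q%:Z = l.+1%:Z - 1 by rewrite /l; lia.
rewrite !superfactorialE (natX 2%N).
rewrite (prodE _ _ _ (fun d => (2 * d) ^ (4 * q - 4 * d + 1))%N) //.
rewrite (prodE _ _ _ (fun d => (2 * d + 1) ^ (2 * d))%N) //.
rewrite (prodE _ _ _ (fun d => (2 * q + 1 + 2 * d) ^ (2 * q + 1 - 2 * d))%N) //.
rewrite oddE.
have -> : ((2 * q + 1) ^ 2 + (2 * q + 1) - 1 = l.+1 ^ 2 + l)%N.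
  by rewrite (_ : 2 * q + 1 = l.+1)%N /l; lia.
rewrite -3!(mulrA (_ / _)).
apply: natr_ratio (odd_region_count q hs) _ _ _; rewrite ?prod_fact_gt0 //.
by rewrite odd_products !natrM !mulrA.
Qed.
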